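(* Let $n\ge 3$, let $\Omega\subset\mathbb{R}^n$ be a bounded domain with smooth boundary, and let $u$ solve $\Delta u=-n$ in $\Omega$, $u=0$ on $\partial\Omega$. Let $N$ be a connected component of $\Omega\setminus\mathrm{MAX}(u)$. Then the expected core radius $R(u,N)$ is well-defined (i.e. $\tau(u,N)\ge 1$, so that $\tau(u,N)$ lies in the range of $\tau_1$ or $\tau_2$) and $R(u,N)\ge 0$. Moreover, $R(u,N)=0$ if and only if $(\Omega,u)$ is equivalent to the Serrin solution $(\Omega_0,u_0)$, where $\Omega_0=B_1(0)$ and $u_0(x)=\frac{1-|x|^2}{2}$.
   Context: Notation: $u_{\max}=\max_{\Omega}u$ and $\mathrm{MAX}(u)=\{x\in\Omega: u(x)=u_{\max}\}$. Two solutions $(\Omega,u)$, $(\bar\Omega,\bar u)$ of this problem are equivalent if there are $\lambda>0$, $c\in\mathbb{R}^n$ with $\bar\Omega=\{\lambda x+c: x\in\Omega\}$ and $\bar u(y)=\lambda^2u((y-c)/\lambda)$. Normalized Wall Shear Stress (NWSS): for a connected component $S$ of $\partial\Omega$, $\tau(u,S)=\max_S|\nabla u|/\sqrt{2u_{\max}}$; for a connected component $N$ of $\Omega\setminus\mathrm{MAX}(u)$, $\tau(u,N)=\max\{\tau(u,S): S$ a connected component of $\partial\Omega\cap\overline N\}$ (this set of components is nonempty). Model solutions: let $R_{\max}=\sqrt{(n-2)/n}$. For $R\in(0,R_{\max})$ the function $f_R(r)=1-r^2-\frac{2R^n}{(n-2)r^{n-2}}$ has exactly two positive zeros $r_1=r_1(R)<R<r_2=r_2(R)$;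 the function $u_R(x)=\frac{1-|x|^2}{2}-\frac{R^n}{(n-2)|x|^{n-2}}$ solves the problem on $\Omega_R=\{r_1<|x|<r_2\}$, with maximum $(u_R)_{\max}=\frac12\big(1-\frac{n}{n-2}R^2\big)$ attained on $\{|x|=R\}$. For $R=0$ one takes $u_0$ above, with $r_2(0)=1$. Inner NWSS $\tau_1:(0,R_{\max}]\to[\sqrt n,+\infty)$: $\tau_1(R)=\frac{r_1(R^n/r_1^n-1)}{\sqrt{1-nR^2/(n-2)}}$ for $R<R_{\max}$, $\tau_1(R_{\max})=\sqrt n$; it is continuous, strictly decreasing, tends to $+\infty$ as $R\to0^+$. Outer NWSS $\tau_2:[0,R_{\max})\to[1,\sqrt n)$: $\tau_2(0)=1$, $\tau_2(R)=\frac{r_2(1-R^n/r_2^n)}{\sqrt{1-nR^2/(n-2)}}$ for $R>0$; it is continuous, strictly increasing, tends to $\sqrt n$ as $R\to R_{\max}$. Expected core radius: $R(u,N)=\tau_2^{-1}(\tau(u,N))$ if $\tau(u,N)<\sqrt n$ and $R(u,N)=\tau_1^{-1}(\tau(u,N))$ if $\tau(u,N)\ge\sqrt n$ (similarly $R(u,S)$ for a boundary component $S$). *)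

(* Defs.v *)
From HB Require Import structures.
From mathcomp Require Import all_boot all_order all_algebra.
From mathcomp Require Import all_classical all_reals all_analysis.
Set Implicit Arguments. Unset Strict Implicit. Unset Printing Implicit Defensive.
Import Order.TTheory GRing.Theory Num.Theory.
Import numFieldNormedType.Exports.
Local Open Scope classical_set_scope.
Local Open Scope ring_scope.

Section Defs.
Variables (R : realType) (n : nat).
Local Notation V := 'rV[R]_n.

Definition ebase (i : 'I_n) : V := delta_mx 0 i.

Definition partial (i : 'I_n) (f : V -> R) (x : V) : R := 'D_(ebase i) f x.

Definition enorm (x : V) : R := Num.sqrt (\sum_(i < n) x 0 i ^+ 2).

Fixpoint Ck (k : nat) (A : set V) (f : V -> R) : Prop :=
  match k with
  | O => forall x, A x -> {for x, continuous f}
  | S k => (forall x, A x -> {for x, continuous f}) /\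
           forall i, (forall x, A x -> derivable f x (ebase i)) /\ Ck k A (partial i f)
  end.

Definition smooth_on (A : set V) (f : V -> R) : Prop := forall k, Ck k A f.

(* boundary of an open set *)
Definition bd (A : set V) : set V := closure A `\` A.

Definition bounded_dom (A : set V) : Prop := exists M : R, forall x, A x -> enorm x <= M.

Definition smooth_bounded_domain (Om : set V) : Prop :=
  [/\ open Om, connected Om, Om !=set0, bounded_dom Om &
   forall p, bd Om p -> exists (U : set V) (phi : V -> R),
     [/\ open U, U p, smooth_on U phi,
         (forall x, U x -> exists i, partial i phi x != 0) &
         Om `&` U = [set x | U x /\ phi x < 0]]].

(* classical solution of Delta u = -n in Om, u = 0 on bd Om, with u in
   C^2(Om) and C^1 up to the boundary: g i is the continuous extension of
   partial i u to closure Om *)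
Definition serrin_solution (Om : set V) (u : V -> R) (g : 'I_n -> V -> R) : Prop :=
  [/\ Ck 2 Om u,
      {within closure Om, continuous u},
      (forall x, bd Om x -> u x = 0),
      (forall x, Om x -> \sum_(i < n) partial i (partial i u) x = - n%:R) &
      forall i, {within closure Om, continuous (g i)} /\
                (forall x, Om x -> g i x = partial i u x)].

Definition umax (Om : set V) (u : V -> R) : R := sup [set u x | x in Om].

Definition MAX (Om : set V) (u : V -> R) : set V :=
  [set x | Om x /\ u x = umax Om u].

Definition gradnorm (g : 'I_n -> V -> R) (x : V) : R :=
  Num.sqrt (\sum_(i < n) g i x ^+ 2).

Definition tauS (Om : set V) (u : V -> R) (g : 'I_n -> V -> R) (S : set V) : R :=
  sup [set gradnorm g p | p in S] / Num.sqrt (2 * umax Om u).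

Definition components (A : set V) : set (set V) :=
  [set C | exists2 x, A x & C = connected_component A x].

Definition tauN (Om : set V) (u : V -> R) (g : 'I_n -> V -> R) (N : set V) : R :=
  sup [set tauS Om u g S | S in components (bd Om `&` closure N)].

End Defs.

Section Model.
Variables (R : realType) (n : nat).
Local Notation nr := (n%:R : R).

Definition Rmax : R := Num.sqrt ((nr - 2) / nr).

Definition fR (Rc r : R) : R := 1 - r ^+ 2 - 2 * Rc ^+ n / ((nr - 2) * r ^+ (n - 2)).

Definition r1 (Rc : R) : R := xget 0 [set r | 0 < r < Rc /\ fR Rc r = 0].
Definition r2 (Rc : R) : R := xget 0 [set r | Rc < r /\ fR Rc r = 0].

Definition tau1 (Rc : R) : R :=
  if Rc < Rmax then
    r1 Rc * (Rc ^+ n / r1 Rc ^+ n - 1) / Num.sqrt (1 - nr * Rc ^+ 2 / (nr - 2))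
  else Num.sqrt nr.

Definition tau2 (Rc : R) : R :=
  if Rc == 0 then 1 else
    r2 Rc * (1 - Rc ^+ n / r2 Rc ^+ n) / Num.sqrt (1 - nr * Rc ^+ 2 / (nr - 2)).

Definition core_radius (t : R) : R :=
  if t < Num.sqrt nr then xget 0 [set Rc | 0 <= Rc < Rmax /\ tau2 Rc = t]
  else xget 0 [set Rc | 0 < Rc <= Rmax /\ tau1 Rc = t].

End Model.

Definition equivalent (R : realType) (n : nat) (Om : set 'rV[R]_n) (u : 'rV[R]_n -> R)
  (Omb : set 'rV[R]_n) (ub : 'rV[R]_n -> R) : Prop :=
  exists (lam : R) (c : 'rV[R]_n), 0 < lam /\
    Omb = [set lam *: x + c | x in Om] /\
    forall y, Omb y -> ub y = lam ^+ 2 * u (lam^-1 *: (y - c)).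

Definition Omega0 (R : realType) (n : nat) : set 'rV[R]_n := [set x | enorm x < 1].
Definition u0 (R : realType) (n : nat) (x : 'rV[R]_n) : R := (1 - enorm x ^+ 2) / 2.

(* Main.v *)
Require Import Defs.
From HB Require Import structures.
From mathcomp Require Import all_boot all_order all_algebra.
From mathcomp Require Import all_classical all_reals all_analysis.
From mathcomp Require Import ring lra.
Import Order.TTheory GRing.Theory Num.Theory.
Import numFieldNormedType.Exports.
Local Open Scope classical_set_scope.
Local Open Scope ring_scope.

(** Put [v = umax - u]. Suppose [|grad u|^2 <= 2 umax] on the part of the boundary
    of [Om] adherent to [N], that is [tau(u, N) <= 1].

    The function [P = |grad u|^2 + 2 u] obeys the maximum principle, hence
    [|grad v|^2 <= 2 v] on [N]. A solution is only assumed twice differentiable,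
    so [P] is not differentiated: at a maximum [p] one minorises [|grad u|^2] by
    [2 a . grad u - |a|^2] with [a = grad u (p) - (x - p)], which turns [P] into a
    function that is linear in [u], formally harmonic, and a limit of exactly
    harmonic functions obtained from dilations of [u + |x - p|^2 / 2].

    A cube contained in [N] and touching the maximum set at [p] contains a piece of
    each coordinate half-line from [p]; expanding [|grad v|^2 <= 2 v] along them
    gives [sum_j A_ji^2 <= A_ii] for the Hessian [A] of [v] at [p]. As [tr A = n],
    [A] is the identity, so [p] is isolated and [N] contains a punctured neighbourhood
    of [p]. Integrating [|grad v|^2 <= 2 v] along rays gives [v <= |x - p|^2 / 2], where
    the difference is harmonic and vanishes at [p]: by the strong maximum principle
    [v = |x - p|^2 / 2] on every ball about [p] punctured in [N], and the largest
    such ball is [Om]. On a ball [tau = 1].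

    The core radius vanishes exactly at [tau = 1] because, for [s = Rc / r], both
    [tau1] and [tau2] are square roots of one rational function of [s], which
    equals [1] at [s = 0] only, and [n] at [s = 1], and is unbounded. *)

Set Implicit Arguments.
Unset Strict Implicit.
Unset Printing Implicit Defensive.

(** * The model functions *)

Section ModelPolynomials.
Variable R : realType.
Implicit Types (m : nat) (s : R).

(** The geometric sum 1 + X + ... + X^(m-1) in Horner form. *)
Fixpoint geomp m : {poly R} := if m is k.+1 then 1 + 'X * geomp k else 0.

(** The quotient of m + 2 X^(m+2) - (m+2) X^2 by its double factor (1 - X)^2, written so that its
    coefficients are visibly nonnegative. With n = m + 2 it is, up to a factor, the model height as
    a function of the ratio s = Rc / r. *)
Fixpoint heightp m : {poly R} :=
  if m is k.+1 then 'X * heightp k + (k.+1%:R + k.+2%:R *: 'X) else 0.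

Lemma geomp_recr m s : (geomp m.+1).[s] = 1 + s * (geomp m).[s].
Proof. by rewrite /= !hornerE. Qed.

Lemma heightp_recr m s :
  (heightp m.+1).[s] = s * (heightp m).[s] + (m.+1%:R + m.+2%:R * s).
Proof. by rewrite /= !hornerE -!polyC_natr !hornerE. Qed.

Lemma geompE m s : (1 - s) * (geomp m).[s] = 1 - s ^+ m.
Proof.
elim: m => [|m IH]; first by rewrite horner0 expr0; ring.
by rewrite geomp_recr mulrDr mulrCA IH exprS; ring.
Qed.

Lemma heightpE m s :
  (1 - s) ^+ 2 * (heightp m).[s] = m%:R + 2 * s ^+ m.+2 - m.+2%:R * s ^+ 2.
Proof.
elim: m => [|m IH]; first by rewrite horner0; ring.
rewrite heightp_recr mulrDr mulrCA IH !exprS -[in LHS](natr1 m.+1) -!natr1; ring.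
Qed.

Lemma geomp_ge m s : 0 <= s -> 1 <= (geomp m.+1).[s].
Proof.
move=> s0; elim: m => [|m IH]; first by rewrite geomp_recr horner0 mulr0 addr0.
rewrite geomp_recr lerDl mulr_ge0 //; exact: le_trans IH.
Qed.

Lemma geomp_gt m s : 0 < s -> 1 + s < (geomp m.+3).[s].
Proof.
move=> s0; rewrite geomp_recr ltrD2l -[ltLHS]mulr1 ltr_pM2l //.
rewrite geomp_recr ltrDl mulr_gt0 //.
exact: lt_le_trans (geomp_ge m (ltW s0)).
Qed.

Lemma heightp_gt0 m s : 0 <= s -> 0 < (heightp m.+1).[s].
Proof.
move=> s0; elim: m => [|m IH]; rewrite heightp_recr.
  by rewrite horner0 mulr0 add0r ltr_pwDl // mulr_ge0.
by rewrite ltr_wpDl ?ltr_pwDl ?mulr_ge0 // ltW.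
Qed.

Lemma heightp_le m s : 0 <= s ->
  (heightp m).[s] <= m%:R * ((1 + s) * (geomp m.+1).[s]).
Proof.
move=> s0; elim: m => [|m IH]; first by rewrite horner0 mul0r.
rewrite heightp_recr.
have E : (geomp m.+2).[s] = 1 + s * (geomp m.+1).[s] by rewrite geomp_recr.
have := ler_wpM2l s0 IH.
have : 1 + s <= (geomp m.+2).[s].
  by rewrite E lerD2l -[leLHS]mulr1 ler_wpM2l // geomp_ge.
rewrite {}E -!natr1.
set S := (geomp m.+1).[s]; set H := (heightp m).[s]; set N := (m%:R : R).
nra.
Qed.

(** For n = m + 3 this strict inequality keeps the shear stress of a model with positive core radius
    above 1. In the bound of [heightp_le], one copy of [geomp] strictly dominates 1 + s and the
    other dominates the shorter geometric sum. *)
Lemma heightp_lt m s : 0 < s ->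
  (heightp m.+1).[s] < m.+1%:R * (geomp m.+3).[s] ^+ 2.
Proof.
move=> s0; apply: le_lt_trans (heightp_le m.+1 (ltW s0)) _.
rewrite ltr_pM2l ?ltr0n // expr2.
have S1 : (geomp m.+2).[s] <= (geomp m.+3).[s].
  rewrite -subr_ge0; elim: {1 2}m.+2 => [|k IH].
    by rewrite geomp_recr horner0 mulr0 subr0 addr0.
  rewrite geomp_recr [X in _ - X]geomp_recr.
  by rewrite opprD addrACA subrr add0r -mulrBr mulr_ge0 // ltW.
have S2 := geomp_gt m s0.
have S0 : 1 <= (geomp m.+2).[s] by exact: geomp_ge (ltW s0).
nra.
Qed.

Lemma geomp1 m : (geomp m).[1] = m%:R.
Proof.
elim: m => [|m IH]; first by rewrite horner0.
by rewrite geomp_recr mul1r IH -natr1 addrC.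
Qed.

Lemma heightp1 m : (heightp m).[1] = m%:R * m.+2%:R.
Proof.
elim: m => [|m IH]; first by rewrite horner0 mul0r.
by rewrite heightp_recr IH -!natr1; ring.
Qed.

Lemma geomp_at0 m : (geomp m.+1).[0] = 1.
Proof. by rewrite geomp_recr mul0r addr0. Qed.

Lemma heightp_at0 m : (heightp m).[0] = m%:R.
Proof. by case: m => [|m]; rewrite ?horner0 // heightp_recr mul0r mulr0 add0r addr0. Qed.

End ModelPolynomials.

(** * Both shear stresses as functions of the ratio s = Rc / r *)

Section Model.
Variables (R : realType) (m : nat).
Hypothesis m_gt0 : (0 < m)%N.
Local Notation n := m.+2.
Implicit Types (Rc r s t : R).

Let m0 : 0 < (m%:R : R). Proof. by rewrite ltr0n. Qed.

Lemma natSS_sub2 : (n%:R : R) - 2 = m%:R.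
Proof. by rewrite -!natr1; ring. Qed.

Lemma fRE Rc r : fR n Rc r = 1 - r ^+ 2 - 2 * Rc ^+ n / (m%:R * r ^+ m).
Proof. by rewrite /fR natSS_sub2 subn2. Qed.

(** In terms of s = Rc / r the zero equation becomes explicit in r, so that s parametrises the model
    solutions. *)
Lemma fR_ratio Rc r : 0 < r -> fR n Rc r = 0 ->
  r ^+ 2 * (m%:R + 2 * (Rc / r) ^+ n) = m%:R.
Proof.
move=> r0 /eqP; rewrite fRE => /eqP H.
have rn : r != 0 by rewrite gt_eqF.
have mn : (m%:R : R) != 0 by rewrite gt_eqF.
have rm : r ^+ m != 0 by rewrite expf_neq0.
have -> : (Rc / r) ^+ n = Rc ^+ n / (r ^+ m * r ^+ 2).
  by rewrite expr_div_n -exprD addn2.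
transitivity (m%:R * (r ^+ 2 + 2 * Rc ^+ n / (m%:R * r ^+ m))).
  by field; rewrite rn mn rm.
have -> : r ^+ 2 + 2 * Rc ^+ n / (m%:R * r ^+ m) = 1 by lra.
by rewrite mulr1.
Qed.

Lemma fR_derive Rc r : 0 < r ->
  is_derive r 1 (fR n Rc) (- (2 * r) + 2 * Rc ^+ n / r ^+ m.+1).
Proof.
move=> r0; have rn : r != 0 by rewrite gt_eqF.
have mn : (m%:R : R) != 0 by rewrite gt_eqF.
have -> : fR n Rc = (cst 1 - (fun x => x ^+ 2)) -
    (2 * Rc ^+ n / m%:R) *: (fun x => (x ^+ m)^-1).
  apply/funext => x; rewrite fRE /= !fctE; congr (_ - _).
  by rewrite invfM mulrA.
have dX k : is_derive r 1 (fun x : R => x ^+ k) (k%:R * r ^+ k.-1).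
  apply: DeriveDef; first exact: exprn_derivable.
  by rewrite exp_derive; rewrite [_ *: 1]mulr1.
have dV : is_derive r 1 (fun x : R => (x ^+ m)^-1)
    (- (r ^+ m) ^- 2 * (m%:R * r ^+ m.-1)).
  have rm : r ^+ m != 0 by rewrite expf_neq0.
  have dm := ex_derive (is_derive := dX m).
  apply: DeriveDef; first exact: (@derivableV R R (fun x => x ^+ m) r 1 rm dm).
  by rewrite (@deriveV R R (fun x => x ^+ m) r 1 rm dm) (derive_val (is_derive := dX m)).
apply: is_derive_eq.
rewrite /GRing.scale /= expr1.
have -> : r ^+ m = r * r ^+ m.-1 by rewrite -exprS prednK.
have -> : r ^+ m.+1 = r * (r * r ^+ m.-1) by rewrite -!exprS prednK.
have rm1 : r ^+ m.-1 != 0 by rewrite expf_neq0.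
by field; rewrite rn mn rm1.
Qed.

(** The derivative of [fR] vanishes on the positive axis only at Rc, so Rolle's theorem allows one
    zero on either side of Rc. This determines the values that [xget] picks in [r1] and [r2]. *)
Lemma fR_zero_unique Rc (a b : R) : 0 < Rc -> 0 < a -> a < b ->
  (b <= Rc \/ Rc <= a) -> fR n Rc a = 0 -> fR n Rc b <> 0.
Proof.
move=> R0 a0 ab side fa fb.
have df x : x \in `[a, b] -> derivable (fR n Rc) x 1.
  rewrite in_itv /= => /andP[ax _].
  by have [] := fR_derive Rc (lt_le_trans a0 ax).
have [||c + /@derive_val dc] := Rolle ab _ _ (etrans fa (esym fb)).
- by move=> x /subset_itv_oo_cc; exact: df.
- exact: derivable_within_continuous.
rewrite in_itv /= => /andP[ac cb].
have c0 := lt_trans a0 ac.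
have cn : c != 0 by rewrite gt_eqF.
have := derive_val (is_derive := fR_derive Rc c0); rewrite dc => /esym E.
have {}E : c ^+ n = Rc ^+ n.
  apply/eqP; rewrite -subr_eq0; apply/eqP.
  have: c ^+ m.+1 * (- (2 * c) + 2 * Rc ^+ n / c ^+ m.+1) = 0 by rewrite E mulr0.
  rewrite mulrDr mulrCA mulfV ?expf_neq0 // [c ^+ n]exprSr => H; lra.
have cR : c = Rc by apply/eqP; rewrite -(eqrXn2 (ltn0Sn m.+1)) ?ltW // E.
by move: ac cb; rewrite cR; case: side => ? ? ?; lra.
Qed.

Lemma r2_eq Rc r : 0 < Rc -> Rc < r -> fR n Rc r = 0 -> r2 n Rc = r.
Proof.
move=> R0 Rr fr; apply: xget_unique => //= y [Ry fy].
case: (ltgtP y r) => // yr.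
- by have := fR_zero_unique R0 (lt_trans R0 Ry) yr (or_intror (ltW Ry)) fy.
- by have := fR_zero_unique R0 (lt_trans R0 Rr) yr (or_intror (ltW Rr)) fr.
Qed.

Lemma r1_eq Rc r : 0 < r -> r < Rc -> fR n Rc r = 0 -> r1 n Rc = r.
Proof.
move=> r0 rR fr; have R0 := lt_trans r0 rR.
apply: xget_unique => /=; first by rewrite r0.
move=> y [/andP[y0 yR] fy]; case: (ltgtP y r) => // yr.
- by have := fR_zero_unique R0 y0 yr (or_introl (ltW rR)) fy.
- by have := fR_zero_unique R0 r0 yr (or_introl (ltW yR)) fr.
Qed.

Lemma model_height Rc r : 0 < r -> fR n Rc r = 0 ->
  1 - n%:R * Rc ^+ 2 / (n%:R - 2) =
  r ^+ 2 * (1 - Rc / r) ^+ 2 * ((heightp R m).[Rc / r] / m%:R).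
Proof.
move=> r0 f0; have rn : r != 0 by rewrite gt_eqF.
have mn : (m%:R : R) != 0 by rewrite gt_eqF.
rewrite natSS_sub2 -[RHS]mulrA [X in _ = _ * X]mulrA heightpE.
(* Replacing the constant 1 by means of the zero equation turns the left side into r^2 times a
   function of s alone. *)
have {1}-> : 1 = r ^+ 2 * (m%:R + 2 * (Rc / r) ^+ n) / m%:R :> R.
  by rewrite fR_ratio // mulfV.
rewrite exprMn exprVn; field.
by rewrite mn rn expf_neq0.
Qed.

(* In terms of [s = Rc / r] both shear stresses are given by one formula: the
   double zero of the model height at [s = 1] cancels against the zero of
   [1 - s ^+ n]. *)
Lemma model_tau Rc r : 0 < r -> 0 < Rc -> Rc != r -> fR n Rc r = 0 ->
  r * `|1 - Rc ^+ n / r ^+ n| / Num.sqrt (1 - n%:R * Rc ^+ 2 / (n%:R - 2)) =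
  (geomp R n).[Rc / r] / Num.sqrt ((heightp R m).[Rc / r] / m%:R).
Proof.
move=> r0 R0 Rr f0.
have s0 : 0 < Rc / r by rewrite divr_gt0.
have s1 : 1 - Rc / r != 0.
  by rewrite subr_eq0 eq_sym; apply: contra Rr => /eqP /divr1_eq ->.
have S0 : 0 < (geomp R n).[Rc / r].
  by apply: lt_le_trans ltr01 _; apply: geomp_ge; exact: ltW.
have Q0 : 0 < Num.sqrt ((heightp R m).[Rc / r] / m%:R).
  by rewrite sqrtr_gt0 divr_gt0 //; case: (m) m_gt0 => // k _; apply: heightp_gt0; exact: ltW.
rewrite -expr_div_n -geompE normrM (gtr0_norm S0).
rewrite (model_height r0 f0) -exprMn sqrtrM ?sqr_ge0 // sqrtr_sqr normrM (gtr0_norm r0).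
field; rewrite (gt_eqF Q0) (gt_eqF r0) normr_eq0 s1 //.
Qed.

(** Squaring and clearing denominators makes the equation for s polynomial, hence accessible to the
    intermediate value theorem for polynomials. *)
Lemma tau_formula_eq s t : 0 < s -> 0 < t ->
  (geomp R n).[s] / Num.sqrt ((heightp R m).[s] / m%:R) = t <->
  m%:R * (geomp R n).[s] ^+ 2 = t ^+ 2 * (heightp R m).[s].
Proof.
move=> s0 t0.
have S0 : 0 < (geomp R n).[s].
  by apply: lt_le_trans ltr01 _; apply: geomp_ge; exact: ltW.
have Q0 : 0 < (heightp R m).[s] by case: (m) m_gt0 => // k _; apply: heightp_gt0; exact: ltW.
have q0 : 0 < Num.sqrt ((heightp R m).[s] / m%:R) by rewrite sqrtr_gt0 divr_gt0.
have q2 : Num.sqrt ((heightp R m).[s] / m%:R) ^+ 2 = (heightp R m).[s] / m%:R.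
  by rewrite sqr_sqrtr // ltW // divr_gt0.
have mn : (m%:R : R) != 0 by rewrite gt_eqF.
have qn := gt_eqF q0.
split => [<-|E].
  rewrite expr_div_n q2; field; rewrite mn gt_eqF //.
apply/eqP; rewrite -(eqrXn2 (ltn0Sn 1)) ?divr_ge0 // ?ltW //.
rewrite expr_div_n q2.
have Qn : (heightp R m).[s] != 0 by rewrite gt_eqF.
have -> : t ^+ 2 = m%:R * (geomp R n).[s] ^+ 2 / (heightp R m).[s] by rewrite E mulfK.
by apply/eqP; field; rewrite mn Qn.
Qed.

Lemma model_radius s : 0 < s -> s != 1 ->
  exists Rc r, [/\ 0 < r, 0 < Rc < Rmax R n, Rc = s * r & fR n Rc r = 0].
Proof.
move=> s0 s1.
have d0 : 0 < 1 + 2 * s ^+ n / m%:R.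
  by rewrite ltr_pwDl // divr_ge0 // mulr_ge0 // exprn_ge0 // ltW.
(* This is [fR_ratio] solved for r. *)
pose r := (Num.sqrt (1 + 2 * s ^+ n / m%:R))^-1.
have r0 : 0 < r by rewrite invr_gt0 sqrtr_gt0.
have mn : (m%:R : R) != 0 by rewrite gt_eqF.
have rn : r != 0 by rewrite gt_eqF.
have r2E : r ^+ 2 * (1 + 2 * s ^+ n / m%:R) = 1.
  by rewrite exprVn sqr_sqrtr ?ltW // mulVf // gt_eqF.
have f0 : fR n (s * r) r = 0.
  rewrite fRE -[X in X - _ - _]r2E exprMn.
  have -> : r ^+ n = r ^+ 2 * r ^+ m by rewrite -exprD.
  by field; rewrite mn expf_neq0.
exists (s * r), r; split => //; rewrite mulr_gt0 //=.
have := model_height r0 f0; rewrite mulfK // => H.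
(* Positivity of the model height for s != 1 is the bound Rc < Rmax. *)
have : 0 < 1 - n%:R * (s * r) ^+ 2 / (n%:R - 2).
  have Q0 : 0 < (heightp R m).[s].
    by case: (m) m_gt0 => // k _; apply: heightp_gt0; exact: ltW.
  have e0 : 0 < (1 - s) ^+ 2 by rewrite exprn_even_gt0 //= subr_eq0 eq_sym.
  by rewrite H mulr_gt0 ?divr_gt0 // mulr_gt0 // exprn_gt0.
rewrite subr_gt0 /Rmax natSS_sub2 ltr_pdivrMr // mul1r => L.
rewrite -[ltLHS]ger0_norm ?mulr_ge0 ?ltW // -sqrtr_sqr ltr_sqrt; last by rewrite divr_gt0 ?ltr0n.
by rewrite ltr_pdivlMr ?ltr0n // mulrC.
Qed.

Lemma tau2_onto t : 1 < t -> t < Num.sqrt n%:R ->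
  exists Rc, 0 <= Rc < Rmax R n /\ tau2 n Rc = t.
Proof.
move=> t1 tn; have t0 := lt_trans ltr01 t1.
have T1 : 1 < t ^+ 2 by rewrite exprn_cp1 ?ltW.
have Tn : t ^+ 2 < n%:R.
  by rewrite -[ltRHS](@sqr_sqrtr R) ?ler0n // ltrXn2r ?ltW.
(* A root s of p in (0, 1) gives an outer radius r > Rc with stress t. The signs come from p(0) = m
   (1 - t^2) and p(1) = m n (n - t^2). *)
pose p := m%:R *: geomp R n ^+ 2 - t ^+ 2 *: heightp R m.
have pE x : p.[x] = m%:R * (geomp R n).[x] ^+ 2 - t ^+ 2 * (heightp R m).[x].
  by rewrite /p !hornerE.
have p0 : p.[0] < 0.
  by rewrite pE geomp_at0 heightp_at0 expr1n mulr1 subr_lt0 ltr_pMl.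
have p1 : 0 < p.[1].
  have -> : p.[1] = m%:R * (n%:R * (n%:R - t ^+ 2)) by rewrite pE geomp1 heightp1; ring.
  by rewrite !mulr_gt0 ?subr_gt0 ?ltr0n.
have [||s] := @poly_ivt R p 0 1; first exact: ler01.
  by rewrite !ltW.
move=> /andP[s0 s1] /rootP ps.
have {}s0 : 0 < s.
  rewrite lt_neqAle s0 andbT eq_sym; apply: contraTneq p0 => sE.
  by move: ps; rewrite sE => ->; rewrite ltxx.
have {}s1 : s < 1.
  rewrite lt_neqAle s1 andbT; apply: contraTneq p1 => sE.
  by move: ps; rewrite sE => ->; rewrite ltxx.
have [||Rc [r [r0 /andP[R0 RR] Rs fr]]] := @model_radius s; rewrite ?lt_eqF //.
exists Rc; rewrite RR ltW //; split => //.
have Rr : Rc < r by rewrite Rs gtr_pMl.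
rewrite /tau2 gt_eqF // (r2_eq R0 Rr fr).
rewrite -[1 - Rc ^+ n / _]ger0_norm; last first.
  by rewrite subr_ge0 ler_pdivrMr ?exprn_gt0 // mul1r lerXn2r ?nnegrE ?ltW.
rewrite model_tau ?lt_eqF //; apply/tau_formula_eq; rewrite ?divr_gt0 //.
have -> : Rc / r = s by rewrite Rs mulfK // gt_eqF.
by apply/eqP; rewrite -subr_eq0 -pE ps.
Qed.

Lemma tau1_onto t : Num.sqrt n%:R <= t ->
  exists Rc, 0 < Rc <= Rmax R n /\ tau1 n Rc = t.
Proof.
rewrite le_eqVlt => /predU1P[<-|tn].
  (* The value sqrt n is taken at Rmax by definition; it corresponds to the excluded ratio s = 1. *)
  exists (Rmax R n); rewrite lexx andbT /tau1 ltxx; split => //.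
  by rewrite sqrtr_gt0 natSS_sub2 divr_gt0 ?ltr0n.
have q0 : 0 < Num.sqrt n%:R :> R by rewrite sqrtr_gt0 ltr0n.
have t0 := lt_trans q0 tn.
have Tn : n%:R < t ^+ 2.
  by rewrite -[ltLHS](@sqr_sqrtr R) ?ler0n // ltrXn2r ?ltW.
pose p := m%:R *: geomp R n ^+ 2 - t ^+ 2 *: heightp R m.
have pE x : p.[x] = m%:R * (geomp R n).[x] ^+ 2 - t ^+ 2 * (heightp R m).[x].
  by rewrite /p !hornerE.
have p1 : p.[1] < 0.
  have -> : p.[1] = m%:R * (n%:R * (n%:R - t ^+ 2)) by rewrite pE geomp1 heightp1; ring.
  by rewrite !pmulr_rlt0 ?ltr0n // subr_lt0.
have T0 : 0 < t ^+ 2 by rewrite exprn_gt0.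
(* Here p(1) < 0 and a root s > 1 is sought. With X = M^n >= M, (1 - M)^2 p(M) = m (1 - X)^2 - t^2
   (m + 2 X - n M^2), and M is large enough that (1 - X)^2 > t^2 (1 + 2 X). *)
pose M := 4 * t ^+ 2 + 4.
have M1 : 1 < M by rewrite /M; lra.
have pM : 0 < p.[M].
  have d0 : 0 < (1 - M) ^+ 2 by rewrite exprn_even_gt0 //= subr_eq0 lt_eqF.
  rewrite -(pmulr_rgt0 _ d0) pE mulrBr mulrCA -exprMn geompE
    [X in _ - X]mulrCA heightpE.
  have XM : M <= M ^+ n by rewrite ler_eXnr // ltW.
  have M20 : 0 <= n%:R * M ^+ 2 by rewrite mulr_ge0 ?sqr_ge0.
  have m1 : 1 <= m%:R :> R by rewrite ler1n.
  move: XM M20; move: (M ^+ n) (n%:R * M ^+ 2) => X Y; rewrite /M => XM Y0.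
  have h1 : (1 - X) ^+ 2 > t ^+ 2 * (1 + 2 * X) by nra.
  have : m%:R * (t ^+ 2 * (1 + 2 * X)) < m%:R * (1 - X) ^+ 2 by rewrite ltr_pM2l.
  have h2 : 0 <= (m%:R - 1) * (t ^+ 2 * (2 * X)).
    have X0 : 0 <= X by lra.
    by rewrite mulr_ge0 ?subr_ge0 // mulr_ge0 ?(ltW T0) // mulr_ge0.
  have := mulr_ge0 (ltW T0) Y0.
  nra.
have [||s] := @poly_ivt R p 1 M; first exact: ltW.
  by rewrite !ltW.
move=> /andP[s1 sM] /rootP ps.
have {}s1 : 1 < s.
  rewrite lt_neqAle s1 andbT eq_sym; apply: contraTneq p1 => sE.
  by move: ps; rewrite sE => ->; rewrite ltxx.
have s0 := lt_trans ltr01 s1.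
have [||Rc [r [r0 /andP[R0 RR] Rs fr]]] := @model_radius s; rewrite ?gt_eqF //.
exists Rc; rewrite R0 ltW //; split => //.
have Rr : r < Rc by rewrite Rs ltr_pMl.
rewrite /tau1 RR (r1_eq r0 Rr fr).
rewrite -[Rc ^+ n / _ - 1]ger0_norm; last first.
  by rewrite subr_ge0 ler_pdivlMr ?exprn_gt0 // mul1r lerXn2r ?nnegrE ?ltW.
rewrite distrC model_tau ?gt_eqF //; apply/tau_formula_eq; rewrite ?divr_gt0 //.
have -> : Rc / r = s by rewrite Rs mulfK // gt_eqF.
by apply/eqP; rewrite -subr_eq0 -pE ps.
Qed.

Lemma tau2_neq1 Rc : 0 < Rc -> tau2 n Rc <> 1.
Proof.
move=> R0; rewrite /tau2 gt_eqF //.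
(* Without a zero, [r2] would be its default 0 and [tau2] would be 0, which is not 1 either. *)
rewrite /r2; case: xgetP => [r _ [Rr fr]|_]; last first.
  by rewrite !mul0r => /esym /eqP; rewrite oner_eq0.
have r0 := lt_trans R0 Rr.
rewrite -[1 - Rc ^+ n / _]ger0_norm; last first.
  by rewrite subr_ge0 ler_pdivrMr ?exprn_gt0 // mul1r lerXn2r ?nnegrE ?ltW.
have s0 : 0 < Rc / r by rewrite divr_gt0.
rewrite model_tau ?lt_eqF // tau_formula_eq // expr1n mul1r => E.
move: E; case: (m) m_gt0 => // k _ E.
by have := heightp_lt k s0; rewrite E ltxx.
Qed.

Lemma core_radius_eq0 t : 1 <= t -> core_radius n t = 0 <-> t = 1.
Proof.
move=> t1; have n1 : 1 < Num.sqrt n%:R :> R.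
  by rewrite -{1}sqrtr1 ltr_sqrt ?ltr0n // ltr1n.
split => [|->]; rewrite /core_radius.
  case: ltP => tn.
    rewrite le_eqVlt in t1; case/predU1P: t1 => [//|t1].
    (* Surjectivity excludes the default of [xget]: a vanishing radius is a genuine preimage of t
       under [tau2], whose value at 0 is 1. *)
    have [] := xgetPex 0 (tau2_onto t1 tn).
    by move=> _ + E; rewrite E /tau2 eqxx.
  have [/andP[+ _] _ E] := xgetPex 0 (tau1_onto tn).
  by rewrite E ltxx.
rewrite n1; case: xgetP => // Rc _ [/andP[]].
by rewrite le_eqVlt => /predU1P[<-//|/tau2_neq1].
Qed.

Lemma core_radius_ge0 t : 0 <= core_radius n t.
Proof.
rewrite /core_radius; case: ifP => _; case: xgetP => // Rc _ [/andP[]] //.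
by move=> /ltW.
Qed.

End Model.

Lemma core_radius_spec (R : realType) (n : nat) (t : R) : (3 <= n)%N -> 1 <= t ->
  0 <= core_radius n t /\ (core_radius n t = 0 <-> t = 1).
Proof.
case: n => [//|[//|m]] m_gt0 t1; split; first exact: core_radius_ge0.
exact: core_radius_eq0.
Qed.

(** * Limits and derivatives in coordinates *)

Section EpsilonDelta.
Variables (R : realType) (n : nat).
Local Notation V := 'rV[R]_n.
Implicit Types (f : V -> R) (x v : V) (A : set V).

Lemma continuous_atP f x : {for x, continuous f} <->
  forall e : R, 0 < e -> exists2 d : R, 0 < d & forall y : V, `|y - x| < d -> `|f y - f x| < e.
Proof.
split => [cf e e0|cf].
  have /cvgrPdist_lt /(_ _ e0) /nbhs_normP[d d0 H] := cf.
  exists d => // y yd; rewrite distrC; apply: H => /=.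
  by rewrite /ball_ /= distrC.
apply/(@cvgrPdist_lt _ _ _ (nbhs x)) => e /cf[d d0 H].
apply: filterS (nbhsx_ballx x d d0) => y.
by rewrite -ball_normE /= distrC => /H; rewrite distrC.
Qed.

Lemma continuous_withinP f A : {within A, continuous f} <->
  forall x, A x -> forall e : R, 0 < e ->
    exists2 d : R, 0 < d & forall y : V, A y -> `|y - x| < d -> `|f y - f x| < e.
Proof.
rewrite subspace_continuousP; split => cf x Ax.
  move=> e e0; have /cvgrPdist_lt /(_ _ e0) := cf x Ax.
  rewrite near_withinE => /nbhs_normP[d d0 H].
  exists d => // y Ay yd; rewrite distrC; apply: H => //=.
  by rewrite /ball_ /= distrC.
apply/(@cvgrPdist_lt _ _ _ (within A (nbhs x))) => e /(cf x Ax)[d d0 H]; rewrite near_withinE.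
apply: filterS (nbhsx_ballx x d d0) => y + Ay.
by rewrite -ball_normE /= distrC => /(H _ Ay); rewrite distrC.
Qed.

Lemma closureP A x : closure A x <->
  forall e : R, 0 < e -> exists2 y : V, A y & `|y - x| < e.
Proof.
split => [cA e e0|H].
  have [|y [Ay]] := cA (ball x e); first exact: nbhsx_ballx.
  by rewrite -ball_normE /= distrC => ?; exists y.
move=> B /nbhs_normP[d d0 dB]; have [y Ay yx] := H _ d0.
by exists y; split => //; apply: dB; rewrite /ball_ /= distrC.
Qed.

Lemma openP A : open A <->
  forall x, A x -> exists2 d : R, 0 < d & forall y : V, `|y - x| < d -> A y.
Proof.
rewrite openE; split => H x /H.
  move=> /nbhs_normP[d d0 dB]; exists d => // y yx; apply: dB.
  by rewrite /ball_ /= distrC.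
move=> [d d0 dB]; apply: filterS (nbhsx_ballx x d d0) => y.
by rewrite -ball_normE /= distrC; exact: dB.
Qed.

End EpsilonDelta.

Section IsDeriveEps.
Variables (R : realType) (V : normedModType R).
Implicit Types (f : V -> R) (x v : V).

(** The division-free form is trivially true at h = 0, so estimates need no punctured
    neighbourhood. *)
Lemma is_deriveP f x v d : is_derive x v f d <->
  forall e : R, 0 < e -> exists2 r : R, 0 < r &
    forall h : R, `|h| < r -> `|f (x + h *: v) - f x - h * d| <= e * `|h|.
Proof.
have key (h a e : R) : h != 0 ->
    (`|d - h^-1 *: a| <= e) = (`|a - h * d| <= e * `|h|).
  move=> hn; rewrite -ler_pdivrMr ?normr_gt0 // -normf_div distrC mulrBl.
  by rewrite [h * d]mulrC mulfK // [a / h]mulrC.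
have E : (h^-1 *: ((f \o shift x) (h *: v) - f x) @[h --> 0^'] --> d) <->
    forall e : R, 0 < e -> exists2 r : R, 0 < r &
    forall h : R, `|h| < r -> `|f (x + h *: v) - f x - h * d| <= e * `|h|.
  split => [/cvgrPdist_le H e /H|H].
    rewrite near_withinE => /nbhs_normP[r r0 rP]; exists r => // h hr.
    have [->|hn] := eqVneq h 0.
      by rewrite scale0r addr0 subrr mul0r subr0 normr0 mulr0.
    have := rP h; rewrite /ball_ /= sub0r normrN => /(_ hr hn).
    by rewrite key // [h *: v + x]addrC.
  apply/(@cvgrPdist_le _ _ _ 0^') => e /H[r r0 rP]; rewrite near_withinE.
  apply: filterS (nbhsx_ballx 0 r r0) => h.
  rewrite -ball_normE /= sub0r normrN => hr hn.
  by rewrite key // [h *: v + x]addrC rP.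
rewrite -E; split => [[df <-]//|cf].
by apply: DeriveDef; [apply/cvg_ex; exists d|exact: cvg_lim cf].
Qed.

End IsDeriveEps.

Section Lines.
Variables (R : realType) (V : normedModType R).
Implicit Types (f : V -> R) (x v : V).

Lemma is_derive_affine f (c x v : V) (s d : R) :
  is_derive (c + s *: x) v f d -> is_derive x v (fun y => f (c + s *: y)) (s * d).
Proof.
move=> /is_deriveP df; apply/is_deriveP => e e0.
have s1 : 0 < `|s| + 1 by rewrite ltr_wpDl.
have [r r0 rP] := df _ (divr_gt0 e0 s1).
exists (r / (`|s| + 1)); first by rewrite divr_gt0.
move=> h hr; have : `|s * h| < r.
  rewrite normrM; apply: le_lt_trans (_ : (`|s| + 1) * `|h| < _).
    by rewrite ler_wpM2r // lerDl.
  by rewrite mulrC -ltr_pdivlMr.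
move=> /rP; rewrite scalerDr scalerA addrA [h * _]mulrCA mulrA.
move=> /le_trans; apply; rewrite normrM mulrA ler_wpM2r //.
by rewrite -mulrA ger_pMr // mulrC ler_pdivrMr // mul1r lerDl.
Qed.

Lemma is_derive_line f x v t d :
  is_derive (x + t *: v) v f d -> is_derive t 1 (fun s : R => f (x + s *: v)) d.
Proof.
move=> /is_deriveP df; apply/is_deriveP => e /df[r r0 rP]; exists r => // h hr.
by rewrite [h *: 1]mulr1 scalerDl addrA rP.
Qed.

Lemma is_derive_scaledir f x v (s d : R) :
  is_derive x v f d -> is_derive x (s *: v) f (s * d).
Proof.
move=> /is_deriveP df; apply/is_deriveP => e e0.
have s1 : 0 < `|s| + 1 by rewrite ltr_wpDl.
have [r r0 rP] := df _ (divr_gt0 e0 s1).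
exists (r / (`|s| + 1)); first by rewrite divr_gt0.
move=> h hr; have : `|s * h| < r.
  rewrite normrM; apply: le_lt_trans (_ : (`|s| + 1) * `|h| < _).
    by rewrite ler_wpM2r // lerDl.
  by rewrite mulrC -ltr_pdivlMr.
move=> /rP; rewrite scalerA [h * (s * d)]mulrCA mulrA [h * s]mulrC.
move=> /le_trans; apply; rewrite normrM mulrA ler_wpM2r //.
by rewrite -mulrA ger_pMr // mulrC ler_pdivrMr // mul1r lerDl.
Qed.

Lemma line_mean_value f x v (d : R -> R) :
  (forall t : R, 0 <= t <= 1 -> is_derive (x + t *: v) v f (d t)) ->
  exists2 c : R, 0 <= c <= 1 & f (x + v) - f x = d c.
Proof.
move=> df.
have dl (t : R) : t \in `[0, 1] -> is_derive t 1 (fun s : R => f (x + s *: v)) (d t).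
  by rewrite in_itv /= => t01; apply: is_derive_line; exact: df.
have cont : {within `[0, 1], continuous (fun s : R => f (x + s *: v))}.
  apply: derivable_within_continuous => t t01.
  exact: (ex_derive (is_derive := dl t t01)).
have dlo (t : R) : t \in `]0, 1[ -> is_derive t 1 (fun s : R => f (x + s *: v)) (d t).
  by move=> t01; apply: dl; exact: subset_itv_oo_cc t01.
have [c c01] := MVT_segment ler01 dlo cont.
rewrite scale0r addr0 scale1r subr0 mulr1 => E.
by exists c => //; move: c01; rewrite in_itv.
Qed.

End Lines.

(** * The Euclidean norm compared with the sup norm *)

Section Norms.
Variables (R : realType) (n : nat).
Local Notation V := 'rV[R]_n.
Implicit Types (x y : V).

Definition sqn x : R := \sum_(i < n) x 0 i ^+ 2.

Lemma enormE x : enorm x = Num.sqrt (sqn x).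
Proof. by []. Qed.

Lemma sqn_ge0 x : 0 <= sqn x.
Proof. by apply: sumr_ge0 => i _; exact: sqr_ge0. Qed.

Lemma sqr_enorm x : enorm x ^+ 2 = sqn x.
Proof. by rewrite sqr_sqrtr // sqn_ge0. Qed.

Lemma enorm_ge0 x : 0 <= enorm x.
Proof. exact: sqrtr_ge0. Qed.

Lemma coord_le_norm x i : `|x 0 i| <= `|x|.
Proof.
rewrite [leRHS]/Num.norm /= mx_normrE.
by apply/bigmax_geP; right => /=; exists (0, i).
Qed.

Lemma norm_leP x (c : R) : 0 <= c -> (`|x| <= c) <-> forall i, `|x 0 i| <= c.
Proof.
move=> c0; split => [xc i|H]; first exact: le_trans (coord_le_norm x i) xc.
rewrite [leLHS]/Num.norm /= mx_normrE; apply/bigmax_leP; split => // -[i j] _ /=.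
by rewrite [i]ord1.
Qed.

Lemma norm_ltP x (c : R) : 0 < c -> (`|x| < c) <-> forall i, `|x 0 i| < c.
Proof.
move=> c0; split => [xc i|H]; first exact: le_lt_trans (coord_le_norm x i) xc.
rewrite [ltLHS]/Num.norm /= mx_normrE; apply/bigmax_ltP; split => // -[i j] _ /=.
by rewrite [i]ord1.
Qed.

Lemma norm_le_enorm x : `|x| <= enorm x.
Proof.
apply/norm_leP => [|i]; first exact: enorm_ge0.
rewrite -(@ler_pXn2r _ 2) ?nnegrE ?enorm_ge0 // sqr_enorm real_normK ?num_real //.
by rewrite /sqn (bigD1 i) //= lerDl sumr_ge0 // => j _; exact: sqr_ge0.
Qed.

Lemma sqr_norm_le x : `|x| ^+ 2 <= sqn x.
Proof. by rewrite -sqr_enorm ler_pXn2r ?nnegrE ?enorm_ge0 // norm_le_enorm. Qed.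

Lemma sqn_le x : sqn x <= n%:R * `|x| ^+ 2.
Proof.
apply: le_trans (_ : \sum_(i < n) `|x| ^+ 2 <= _).
  apply: ler_sum => i _; rewrite -real_normK ?num_real //.
  by rewrite ler_pXn2r ?nnegrE // coord_le_norm.
by rewrite sumr_const card_ord mulr_natl.
Qed.

Lemma sqn0 : sqn 0 = 0.
Proof. by rewrite /sqn big1 // => i _; rewrite mxE expr0n. Qed.

Lemma sqnZ (a : R) x : sqn (a *: x) = a ^+ 2 * sqn x.
Proof. by rewrite /sqn mulr_sumr; apply: eq_bigr => i _; rewrite mxE exprMn. Qed.

Lemma enormZ (a : R) x : enorm (a *: x) = `|a| * enorm x.
Proof. by rewrite !enormE sqnZ sqrtrM ?sqr_ge0 // sqrtr_sqr. Qed.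

Lemma sqn_eq0 x : sqn x = 0 -> x = 0.
Proof.
move=> E; apply/eqP; rewrite -normr_eq0 -sqrf_eq0 eq_le sqr_ge0 andbT.
by rewrite -E sqr_norm_le.
Qed.

Lemma enorm_eq0 x : enorm x = 0 -> x = 0.
Proof. by move=> E; apply: sqn_eq0; rewrite -sqr_enorm E expr0n. Qed.

Definition dotp x y : R := \sum_(i < n) x 0 i * y 0 i.

Lemma sqnD x y : sqn (x + y) = sqn x + 2 * dotp x y + sqn y.
Proof.
rewrite /sqn /dotp mulr_sumr -!big_split /=; apply: eq_bigr => i _.
by rewrite mxE; ring.
Qed.

(** A (A B - C^2) is the sum of the squares (A b_i - C a_i)^2; if A = 0, all a_i vanish. *)
Lemma cauchy_schwarz_sum (a b : 'I_n -> R) :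
  (\sum_i a i * b i) ^+ 2 <= (\sum_i a i ^+ 2) * (\sum_i b i ^+ 2).
Proof.
set A := \sum_i a i ^+ 2; set B := \sum_i b i ^+ 2; set C := \sum_i a i * b i.
have A0 : 0 <= A by apply: sumr_ge0 => i _; exact: sqr_ge0.
have key : 0 <= A ^+ 2 * B - A * C ^+ 2.
  have -> : A ^+ 2 * B - A * C ^+ 2 = \sum_i (A * b i - C * a i) ^+ 2.
    have -> : \sum_i (A * b i - C * a i) ^+ 2 =
        \sum_i (A ^+ 2 * b i ^+ 2 - 2 * A * C * (a i * b i) + C ^+ 2 * a i ^+ 2).
      by apply: eq_bigr => i _; ring.
    by rewrite big_split sumrB /= -!mulr_sumr -/A -/B -/C; ring.
  by apply: sumr_ge0 => i _; exact: sqr_ge0.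
have [AE|An] := eqVneq A 0.
  have a0 i : a i = 0.
    apply/eqP; rewrite -sqrf_eq0 eq_le sqr_ge0 andbT -AE /A.
    by rewrite (bigD1 i) //= lerDl sumr_ge0 // => j _; exact: sqr_ge0.
  by rewrite /C big1 ?expr0n ?AE ?mul0r // => i _; rewrite a0 mul0r.
have A1 : 0 < A by rewrite lt_neqAle eq_sym An.
by rewrite -(ler_pM2l A1) -subr_ge0 mulrA -expr2.
Qed.

Lemma enormD x y : enorm (x + y) <= enorm x + enorm y.
Proof.
rewrite -(@ler_pXn2r _ 2) ?nnegrE ?enorm_ge0 ?addr_ge0 ?enorm_ge0 //.
rewrite sqrrD !sqr_enorm sqnD lerD2r lerD2l -[leRHS]mulr_natl ler_pM2l //.
apply: le_trans (ler_norm _) _; rewrite -(@ler_pXn2r _ 2) ?nnegrE ?mulr_ge0 ?enorm_ge0 //.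
by rewrite exprMn !sqr_enorm real_normK ?num_real // cauchy_schwarz_sum.
Qed.

End Norms.

(** * Calculus from partial derivatives *)

Section Calculus.
Variables (R : realType) (n : nat).
Local Notation V := 'rV[R]_n.
Implicit Types (f : V -> R) (D : 'I_n -> V -> R) (x y p v : V).

Lemma ebaseE (i j : 'I_n) : (ebase R i) 0 j = (j == i)%:R.
Proof. by rewrite mxE eqxx. Qed.

Lemma convex_norm_lt (U : normedModType R) (a b : U) (r t : R) :
  0 <= t -> t <= 1 -> `|a| < r -> `|b| < r -> `|(1 - t) *: a + t *: b| < r.
Proof.
move=> t0 t1 ar br; apply: le_lt_trans (ler_normD _ _) _.
rewrite !normrZ (ger0_norm t0) ger0_norm ?subr_ge0 //.
have [->|tn] := eqVneq t 0; first by rewrite mul0r addr0 subr0 mul1r.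
have {}t0 : 0 < t by rewrite lt_neqAle eq_sym tn.
have := mulr_gt0 t0 (_ : 0 < r - `|b|); rewrite subr_gt0 => /(_ br).
have := mulr_ge0 (_ : 0 <= 1 - t) (_ : 0 <= r - `|a|).
rewrite !subr_ge0 => /(_ t1 (ltW ar)); lra.
Qed.

(** The path from x to y changes one coordinate at a time. It stays in the cube about p, a ball of
    the sup norm, and each of its n edges costs at most K |y - x| by the mean value theorem. *)
Lemma coordinate_lipschitz f D p (r K : R) :
  (forall x, `|x - p| < r ->
     forall i, is_derive x (ebase R i) f (D i x) /\ `|D i x| <= K) ->
  forall x y, `|x - p| < r -> `|y - p| < r -> `|f y - f x| <= n%:R * (K * `|y - x|).
Proof.
move=> fD x y xr yr; have r0 : 0 < r by exact: le_lt_trans xr.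
pose z k : V := \row_i (if (i < k)%N then y 0 i else x 0 i).
have zb (w : V) : (forall i, w 0 i = x 0 i \/ w 0 i = y 0 i) \/
    (exists j (t : R), 0 <= t <= 1 /\ w 0 j = x 0 j + t * (y 0 j - x 0 j) /\
      forall i, i != j -> w 0 i = x 0 i \/ w 0 i = y 0 i) -> `|w - p| < r.
  have xi i : `|x 0 i - p 0 i| < r.
    by have := (iffLR (norm_ltP (x - p) r0)) xr i; rewrite !mxE.
  have yi i : `|y 0 i - p 0 i| < r.
    by have := (iffLR (norm_ltP (y - p) r0)) yr i; rewrite !mxE.
  move=> H; apply/norm_ltP => // i; rewrite !mxE.
  case: H => [/(_ i)[] ->//|[j [t [/andP[t0 t1] [wj wi]]]]].
  have [->|/wi[] ->//] := eqVneq i j.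
  have -> : w 0 j - p 0 j = (1 - t) * (x 0 j - p 0 j) + t * (y 0 j - p 0 j).
    by rewrite wj; ring.
  exact: convex_norm_lt.
suff H k : (k <= n)%N -> `|f (z k) - f x| <= k%:R * (K * `|y - x|).
  by have := H n (leqnn n); rewrite (_ : z n = y) //; apply/rowP => i; rewrite mxE ltn_ord.
elim: k => [_|k IH kn].
  have -> : z 0 = x by apply/rowP => i; rewrite mxE.
  by rewrite subrr normr0 mul0r.
pose o := Ordinal kn; pose d := y 0 o - x 0 o.
have zS : z k.+1 = z k + d *: ebase R o.
  apply/rowP => i; rewrite !mxE eqxx ltnS leq_eqVlt.
  have [E|ne] := eqVneq i o.
    by rewrite E eqxx ltnn /= mulr1 /d addrC subrK.
  by rewrite mulr0 addr0 -val_eqE /= in ne *; rewrite (negPf ne).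
have [t t01|c c01 E] := @line_mean_value R V f (z k) (d *: ebase R o)
    (fun t => d * D o (z k + t *: (d *: ebase R o))).
  apply: is_derive_scaledir; apply: (fD _ _ o).1; apply: zb; right.
  exists o, t; split => //; split; first by rewrite !mxE ltnn !eqxx mulr1.
  move=> i io; rewrite !mxE eqxx (negPf io) !mulr0 addr0.
  by case: ifP => _; [right|left].
have Dc : `|D o (z k + c *: (d *: ebase R o))| <= K.
  apply: (fD _ _ o).2; apply: zb; right.
  exists o, c; split => //; split; first by rewrite !mxE ltnn !eqxx mulr1.
  move=> i io; rewrite !mxE eqxx (negPf io) !mulr0 addr0.
  by case: ifP => _; [right|left].
have dn : `|d| <= `|y - x| by have := coord_le_norm (y - x) o; rewrite !mxE.
rewrite -natr1 mulrDl mul1r zS.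
have -> : f (z k + d *: ebase R o) - f x =
  (f (z k) - f x) + (f (z k + d *: ebase R o) - f (z k)) by ring.
apply: le_trans (ler_normD _ _) _; apply: lerD; first exact: IH (ltnW kn).
rewrite E normrM [K * _]mulrC; exact: ler_pM.
Qed.

Lemma linear_derive (a : 'I_n -> R) x v :
  is_derive x v (fun y : V => \sum_i y 0 i * a i) (\sum_i v 0 i * a i).
Proof.
apply/is_deriveP => e e0; exists 1 => // h _.
rewrite mulr_sumr -!sumrB big1 ?normr0 ?(mulr_ge0 (ltW e0)) // => i _.
by rewrite !mxE; ring.
Qed.

Lemma total_derive f D p (r : R) v : 0 < r ->
  (forall x, `|x - p| < r -> forall i, is_derive x (ebase R i) f (D i x)) ->
  (forall i, {for p, continuous (D i)}) ->
  is_derive p v f (\sum_i v 0 i * D i p).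
Proof.
move=> r0 fD cD; pose L (y : V) := \sum_i y 0 i * D i p.
have dL x w : is_derive x w L (\sum_i w 0 i * D i p) by exact: linear_derive.
suff dF : is_derive p v (f - L) 0.
  have -> : f = (f - L) + L by rewrite subrK.
  by apply: is_derive_eq; rewrite add0r.
apply/is_deriveP => e e0; rewrite /=.
have v1 : 0 < n%:R * (`|v| + 1) + 1 :> R by rewrite ltr_wpDl // mulr_ge0 // addr_ge0.
pose e' := e / (n%:R * (`|v| + 1) + 1).
have e'0 : 0 < e' by rewrite divr_gt0.
have /choice[dl dlP] : forall i, exists d : R, 0 < d /\
    forall y : V, `|y - p| < d -> `|D i y - D i p| < e'.
  by move=> i; have [d d0 H] := (iffLR (continuous_atP _ _)) (cD i) e' e'0; exists d.
pose r' := \big[Num.min/r]_i dl i.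
have r'0 : 0 < r' by apply/bigmin_gtP; split => // i _; case: (dlP i).
have r'r : r' <= r by exact: bigmin_le_id.
have lip := @coordinate_lipschitz (f - L) (fun i y => D i y - D i p) p r' e'.
have /lip {}lip : forall x, `|x - p| < r' -> forall i,
    is_derive x (ebase R i) (f - L) (D i x - D i p) /\ `|D i x - D i p| <= e'.
  move=> x xr i; split.
    have := fD x (lt_le_trans xr r'r) i => dfx.
    apply: is_derive_eq; congr (_ - _).
    rewrite (bigD1 i) //= ebaseE eqxx mul1r big1 ?addr0 // => j ji.
    by rewrite ebaseE (negPf ji) mul0r.
  apply/ltW; apply: (dlP i).2; apply: lt_le_trans xr _.
  exact: bigmin_le_cond.
exists (r' / (`|v| + 1)); first by rewrite divr_gt0 // ltr_wpDl.
move=> h hr; have hv : `|h *: v| < r'.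
  rewrite normrZ; apply: le_lt_trans (_ : `|h| * (`|v| + 1) < _).
    by rewrite ler_wpM2l // lerDl.
  by rewrite -ltr_pdivlMr // ltr_wpDl.
have := lip p (p + h *: v); rewrite subrr normr0 addrC addKr => /(_ r'0 hv).
rewrite mulr0 subr0 => /le_trans; apply.
rewrite normrZ mulrCA /e' mulrAC ler_pdivrMr // -[leRHS]mulrA ler_wpM2l ?(ltW e0) //.
have := normr_ge0 h; have := normr_ge0 v; have : 0 <= n%:R :> R by [].
move: (n%:R : R) `|v| `|h| => N a b N0 a0 b0; nra.
Qed.

(** The second derivative is needed at 0 only: if c > 0, then F1 is positive just to the right of 0,
    and the mean value theorem gives a value of F above F 0. *)
Lemma local_max_derive (F F1 : R -> R) (c e : R) : 0 < e ->
  (forall t : R, `|t| < e -> is_derive t 1 F (F1 t) /\ F t <= F 0) ->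
  is_derive (0 : R) 1 F1 c -> F1 0 = 0 /\ c <= 0.
Proof.
move=> e0 FP dF1.
have itvE (t : R) : t \in `](- e), e[ -> `|t| < e by rewrite in_itv /= ltr_norml.
have F10 : F1 0 = 0.
  have [d0 _] : is_derive (0 : R) 1 F (F1 0) /\ F 0 <= F 0.
    by apply: FP; rewrite normr0.
  rewrite -(derive_val (is_derive := d0)).
  apply: derive_val; apply: (@derive1_at_max _ F (- e) e).
  - by rewrite ge0_cp // ltW.
  - by move=> t /itvE /FP[[]].
  - by rewrite in_itv /= oppr_lt0 e0.
  - by move=> t /itvE /FP[].
split => //; rewrite leNgt; apply/negP => c0.
have [r r0 rP] := (iffLR (is_deriveP F1 0 1 c)) dF1 (c / 2) (divr_gt0 c0 (ltr0Sn _ 1)).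
pose s := Num.min e r / 2.
have m0 : 0 < Num.min e r by rewrite lt_min e0.
have s0 : 0 < s by rewrite divr_gt0.
have : s < Num.min e r by rewrite /s ltr_pdivrMr // ltr_pMr // ltr1n.
rewrite lt_min => /andP[se sr].
have dF (t : R) : t \in `[0, s] -> is_derive t 1 F (F1 t).
  rewrite in_itv /= => /andP[t0 ts]; apply: (FP _ _).1.
  by rewrite ger0_norm // (le_lt_trans ts).
have cont : {within `[0, s], continuous F}.
  by apply: derivable_within_continuous => t /dF[].
have dFo (t : R) : t \in `]0, s[ -> is_derive t 1 F (F1 t).
  by move=> ts; apply: dF; exact: subset_itv_oo_cc ts.
have [t + E] := MVT s0 dFo cont.
rewrite in_itv /= => /andP[t0 ts].
have Fs : F s <= F 0 by apply: (FP _ _).2; rewrite gtr0_norm.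
have := rP t; rewrite gtr0_norm // => /(_ (lt_trans ts sr)).
rewrite add0r [t *: 1]mulr1 F10 subr0 ler_norml => /andP[L _].
have F1t : 0 < F1 t by nra.
have : 0 < F1 t * (s - 0) by rewrite subr0 mulr_gt0.
by rewrite -E; lra.
Qed.

Lemma max_second_partials f D (D2 : 'I_n -> R) x (e : R) : 0 < e ->
  (forall y, `|y - x| < e -> f y <= f x) ->
  (forall y, `|y - x| < e -> forall i, is_derive y (ebase R i) f (D i y)) ->
  (forall i, is_derive x (ebase R i) (D i) (D2 i)) ->
  forall i, D i x = 0 /\ D2 i <= 0.
Proof.
move=> e0 fx fD dD i.
have en : 0 < (`|ebase R i| + 1) by rewrite ltr_wpDl.
have := @local_max_derive (fun t => f (x + t *: ebase R i))
  (fun t => D i (x + t *: ebase R i)) (D2 i) (e / (`|ebase R i| + 1)).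
rewrite scale0r addr0; apply; first by rewrite divr_gt0.
  move=> t te; have xt : `|(x + t *: ebase R i) - x| < e.
    rewrite addrC addKr normrZ; apply: le_lt_trans (_ : `|t| * (`|ebase R i| + 1) < _).
      by rewrite ler_wpM2l // lerDl.
    by rewrite -ltr_pdivlMr.
  split; last exact: fx.
  by apply: is_derive_line; exact: fD.
by apply: is_derive_line; rewrite scale0r addr0.
Qed.

End Calculus.

(** * Components of open sets *)

Section ContinuousAt.
Variables (R : realType) (T : topologicalType).
Implicit Types (f g : T -> R) (x : T).

Lemma continuous_at_cst (c : R) x : {for x, continuous (fun=> c : R)}.
Proof. exact: cst_continuous. Qed.

Lemma continuous_atD f g x : {for x, continuous f} -> {for x, continuous g} ->
  {for x, continuous (fun y => f y + g y)}.
Proof. exact: continuousD. Qed.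

Lemma continuous_atM f g x : {for x, continuous f} -> {for x, continuous g} ->
  {for x, continuous (fun y => f y * g y)}.
Proof. exact: continuousM. Qed.

Lemma continuous_atN f x : {for x, continuous f} ->
  {for x, continuous (fun y => - f y)}.
Proof. exact: continuousN. Qed.

Lemma continuous_atX f k x : {for x, continuous f} ->
  {for x, continuous (fun y => f y ^+ k)}.
Proof.
move=> cf; elim: k => [|k IH]; first exact: continuous_at_cst.
under [X in {for _, continuous X}]eq_fun do rewrite exprS.
exact: continuous_atM.
Qed.

End ContinuousAt.

Section Topology.
Variables (R : realType) (n : nat).
Local Notation V := 'rV[R]_n.
Implicit Types (A W N : set V) (x y p : V).

Lemma continuous_sum (T : topologicalType) (f : 'I_n -> T -> R) :
  (forall i, continuous (f i)) -> continuous (fun z => \sum_i f i z).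
Proof.
move=> cf z; apply: cvg_big => [|i _]; last exact: cf.
exact: add_continuous.
Qed.

Lemma continuous_sqr (T : topologicalType) (f : T -> R) :
  continuous f -> continuous (fun z => f z ^+ 2).
Proof. by move=> cf z; apply: cvgM; exact: cf. Qed.

Lemma sqn_continuous (c : V) : continuous (fun x => sqn (x - c)).
Proof.
apply: continuous_sum => i; apply: continuous_sqr => x.
apply/continuous_atP => e e0; exists e => // y; apply: le_lt_trans.
by apply: le_trans (coord_le_norm _ i); rewrite !mxE opprB addrA subrK.
Qed.

Lemma evt_max A (f : V -> R) (M : R) : A !=set0 -> closed A ->
  (forall x, A x -> `|x| <= M) -> {within A, continuous f} ->
  exists2 c, A c & forall x, A x -> f x <= f c.
Proof.
move=> A0 clA bA cf.
have cA : compact A.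
  apply: bounded_closed_compact clA; exists M; split; first exact: num_real.
  by move=> K MK x /bA; move=> /le_trans; apply; exact: ltW.
have [c] := compact_EVT_max A0 cA cf.
rewrite inE => Ac H; exists c => // x Ax; apply: H; exact/mem_set.
Qed.

Lemma segment_sub_component W N x y : components W N -> N y ->
  (forall t : R, 0 <= t <= 1 -> W (y + t *: (x - y))) -> N x.
Proof.
move=> [z Wz ->] Nzy seg.
apply: (@connected_component_trans _ _ y) => //.
exists [set y + t *: (x - y) | t in `[0 : R, 1]]; last first.
  by exists 1; rewrite /= ?in_itv /= ?ler01 ?lexx // scale1r addrC subrK.
split.
- by exists 0; rewrite /= ?in_itv /= ?ler01 ?lexx // scale0r addr0.
- by move=> _ [t + <-]; rewrite /= in_itv /=; exact: seg.
- apply: connected_continuous_connected; first exact: segment_connected.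
  apply: continuous_subspaceT => t.
  apply/(@cvgrPdist_lt _ _ _ (nbhs t)) => e e0.
  have d1 : 0 < `|x - y| + 1 by rewrite ltr_wpDl.
  have d0 : 0 < e / (`|x - y| + 1) by rewrite divr_gt0.
  apply: filterS (nbhsx_ballx t _ d0) => s; rewrite -ball_normE /= => ts.
  rewrite opprD addrACA subrr add0r -scalerBl normrZ.
  apply: le_lt_trans (_ : `|t - s| * (`|x - y| + 1) < _).
    by rewrite ler_wpM2l // lerDl.
  by rewrite -ltr_pdivlMr.
Qed.

Lemma component_sub W N : components W N -> N `<=` W.
Proof. by move=> [z _ ->]; exact: connected_component_sub. Qed.

Lemma component_nonempty W N : components W N -> N !=set0.
Proof. by move=> [z Wz ->]; exists z; exact: connected_component_refl. Qed.

Lemma segment_in_cube p (r t : R) x y : 0 <= t <= 1 ->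
  `|x - p| < r -> `|y - p| < r -> `|y + t *: (x - y) - p| < r.
Proof.
move=> /andP[t0 t1] xr yr.
have -> : y + t *: (x - y) - p = (1 - t) *: (y - p) + t *: (x - p).
  by rewrite !scalerBr !scalerBl !scale1r opprB; apply/rowP => i; rewrite !mxE; ring.
exact: convex_norm_lt.
Qed.

Lemma cube_sub_component W N p (r : R) : components W N ->
  (forall x, `|x - p| < r -> W x) ->
  (exists2 y, N y & `|y - p| < r) -> forall x, `|x - p| < r -> N x.
Proof.
move=> CN rW [y Ny yr] x xr; apply: (segment_sub_component CN Ny) => t t01.
exact/rW/segment_in_cube.
Qed.

Lemma component_open W N : open W -> components W N -> open N.
Proof.
move=> /openP oW CN; apply/openP => x Nx.
have [d d0 dW] := oW x (component_sub CN Nx); exists d => //.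
by apply: (cube_sub_component CN dW); exists x => //; rewrite subrr normr0.
Qed.

Lemma component_rel_closed W N x : open W -> components W N ->
  closure N x -> W x -> N x.
Proof.
move=> /openP oW CN /closureP clN Wx; have [d d0 dW] := oW x Wx.
by apply: (cube_sub_component CN dW (clN d d0)); rewrite subrr normr0.
Qed.

(* Two points of [N] not aligned with [p] are joined to any other point by
   segments, one of which avoids [p]. *)
Lemma punctured_cube_sub_component W N p (r : R) :
  (2 <= n)%N -> open W -> components W N ->
  (forall x, `|x - p| < r -> x != p -> W x) ->
  (exists2 y, N y & `|y - p| < r) ->
  ~ W p -> forall x, `|x - p| < r -> x != p -> N x.
Proof.
move=> n2 oW CN rW [y Ny yr] Wp x xr xp.
have yp : y != p by apply: contra_notN Wp => /eqP <-; exact: component_sub Ny.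
have seg z : N z -> `|z - p| < r ->
    N x \/ exists t : R, 0 <= t <= 1 /\ z + t *: (x - z) = p.
  move=> Nz zr.
  have [[t H]|/forallNP H] := pselect (exists t : R, 0 <= t <= 1 /\ z + t *: (x - z) = p).
    by right; exists t.
  left; apply: (segment_sub_component CN Nz) => t t01.
  apply: rW; first exact: segment_in_cube.
  by apply/eqP => E; apply: (H t).
have [//|[t [/andP[t0 t1] Et]]] := seg y Ny yr.
have [i yi] : exists i, y 0 i != p 0 i.
  apply/existsP; rewrite -[X in is_true X]negbK negb_exists; apply: contra yp.
  by move=> /forallP H; apply/eqP/rowP => i; apply/eqP; have := H i; rewrite negbK.
have [j ji] : exists j : 'I_n, j != i.
  have := card_ord n; rewrite (cardD1 i) inE add1n => cE.
  have /card_gt0P[j] : (0 < #|[predD1 'I_n & i]|)%N by rewrite -ltnS cE.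
  by rewrite !inE => /andP[ji _]; exists j.
have [d d0 dN] := (iffLR (openP N)) (component_open oW CN) y Ny.
pose m := Num.min d (r - `|y - p|); have m0 : 0 < m by rewrite lt_min d0 subr_gt0.
pose e := m / (`|ebase R j| + 1) / 2.
have en : 0 < `|ebase R j| + 1 by rewrite ltr_wpDl.
have e0 : 0 < e by rewrite !divr_gt0.
have ne : `|e *: ebase R j| < m.
  rewrite normrZ gtr0_norm // /e mulrAC ltr_pdivrMr // mulrAC ltr_pdivrMr //.
  by have := normr_ge0 (ebase R j); nra.
(* The point z differs from y only in a coordinate j other than i, where y and p differ in
   coordinate i. *)
pose z := y + e *: ebase R j.
have Nz : N z by apply: dN; rewrite addrC addKr (lt_le_trans ne) // ge_min lexx.
have zr : `|z - p| < r.
  rewrite /z addrAC (le_lt_trans (ler_normD _ _)) // -ltrBrDl.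
  by rewrite (lt_le_trans ne) // ge_min lexx orbT.
have [//|[s [/andP[s0 s1] Es]]] := seg z Nz zr.
(* Both segments now pass through p. Coordinate i, common to y and z, forces s = t; coordinate j
   then forces t = 1, that is x = p. *)
exfalso.
have ci k : (y + t *: (x - y)) 0 k = p 0 k by rewrite Et.
have cz k : (z + s *: (x - z)) 0 k = p 0 k by rewrite Es.
have := ci i; have := cz i; have := ci j; have := cz j.
rewrite !mxE !eqxx [i == j]eq_sym (negPf ji) /= !mulr1 !mulr0 !addr0.
have xi : x 0 i != p 0 i.
  apply: contraNneq xp => xiE.
  have := ci i; rewrite !mxE xiE => E.
  have : (1 - t) * (y 0 i - p 0 i) = 0 by lra.
  move=> /eqP; rewrite mulf_eq0 [_ - p 0 i == 0]subr_eq0 (negPf yi) orbF subr_eq0 => /eqP t1E.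
  by rewrite -Et -t1E scale1r addrC subrK.
set a := y 0 i - p 0 i; set b := x 0 i - p 0 i.
have a0 : a != 0 by rewrite subr_eq0.
move=> Ezj Eyj Ezi Eyi.
have st : s = t.
  have H1 : (1 - t) * a + t * b = 0 by rewrite /a /b; lra.
  have H2 : (1 - s) * a + s * b = 0 by rewrite /a /b; lra.
  have : (s - t) * (b - a) = 0 by lra.
  move=> /eqP; rewrite mulf_eq0 !subr_eq0 => /orP[/eqP//|/eqP ba].
  by move: H1; rewrite ba => H1; case/eqP: a0; lra.
move: Ezj; rewrite st => Ezj.
have : (1 - t) * e = 0 by lra.
move=> /eqP; rewrite mulf_eq0 (gt_eqF e0) orbF subr_eq0 => /eqP t1E.
by move: xp; rewrite -Et -t1E scale1r addrC subrK eqxx.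
Qed.

Lemma connected_clopen A (B : set V) : connected A -> B !=set0 -> B `<=` A ->
  open B -> (forall x, closure B x -> A x -> B x) -> B = A.
Proof.
move=> cA B0 BA oB clB; apply: cA => //.
  by exists B => //; rewrite setIC; apply/esym/setIidPl.
exists (closure B); first exact: closed_closure.
apply/seteqP; split => [x Bx|x [Ax cBx]]; last exact: clB.
by split; [exact: BA|exact: subset_closure].
Qed.

End Topology.

(** * Maximum principles *)

Section Harmonic.
Variables (R : realType) (n : nat).
Local Notation V := 'rV[R]_n.
Implicit Types (A : set V) (f z : V -> R) (D : 'I_n -> V -> R) (x y p : V).

(** Only pure second derivatives are recorded, enough for the Laplacian; naming all derivatives
    keeps those of linear combinations explicit. *)
Definition partials2 A f D (D2 : 'I_n -> V -> R) := forall x, A x -> forall i,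
  is_derive x (ebase R i) f (D i x) /\ is_derive x (ebase R i) (D i) (D2 i x).

Lemma partials2D A f D D2 g E E2 : partials2 A f D D2 -> partials2 A g E E2 ->
  partials2 A (fun x => f x + g x) (fun i x => D i x + E i x) (fun i x => D2 i x + E2 i x).
Proof.
move=> Hf Hg x Ax i; have [df ddf] := Hf x Ax i; have [dg ddg] := Hg x Ax i.
by split; exact: is_deriveD.
Qed.

Lemma partials2Z A f D D2 (c : R) : partials2 A f D D2 ->
  partials2 A (fun x => c * f x) (fun i x => c * D i x) (fun i x => c * D2 i x).
Proof.
by move=> Hf x Ax i; have [df ddf] := Hf x Ax i; split; exact: is_deriveZ.
Qed.

Lemma partials2C A (c : R) : partials2 A (fun=> c) (fun _ _ => 0) (fun _ _ => 0).
Proof. by move=> x Ax i; split; exact: is_derive_cst. Qed.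

Lemma coord_derive (c : R) x i :
  is_derive x (ebase R i) (fun y : V => y 0 i - c) 1.
Proof.
apply/is_deriveP => e e0; exists 1 => // h _.
by rewrite !mxE !eqxx !mulr1 (_ : _ - _ - _ = 0) ?normr0 ?(mulr_ge0 (ltW e0)) //; ring.
Qed.

Lemma sqn_derive (c : V) x i :
  is_derive x (ebase R i) (fun y => sqn (y - c)) (2 * (x 0 i - c 0 i)).
Proof.
apply/is_deriveP => e e0; exists e => // h he.
have -> : sqn (x + h *: ebase R i - c) - sqn (x - c) - h * (2 * (x 0 i - c 0 i)) = h ^+ 2.
  rewrite [x + _ - c]addrAC (sqnD (x - c)) sqnZ.
  have -> : sqn (ebase R i) = 1.
    rewrite /sqn (bigD1 i) //= ebaseE eqxx expr1n big1 ?addr0 // => j ji.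
    by rewrite ebaseE (negPf ji) expr0n.
  have -> : dotp (x - c) (h *: ebase R i) = h * (x 0 i - c 0 i).
    rewrite /dotp (bigD1 i) //= big1 => [|j ji].
      by rewrite !mxE !eqxx mulr1 addr0 mulrC.
    by rewrite !mxE (negPf ji) andbF !mulr0.
  by ring.
by rewrite expr2 normrM ler_wpM2r // ltW.
Qed.

Lemma partials2_sqn A (c : V) : partials2 A (fun y => sqn (y - c))
  (fun i y => 2 * (y 0 i - c 0 i)) (fun _ _ => 2).
Proof.
move=> x Ax i; split; first exact: sqn_derive.
have := coord_derive (c 0 i) x i => dc.
by apply: (is_derive_eq (is_deriveZ _ dc)); rewrite [_ *: _]mulr1.
Qed.

Lemma partials2_coord A (a : 'I_n -> R) (c : V) :
  partials2 A (fun y => \sum_i (y 0 i - c 0 i) * a i) (fun i _ => a i) (fun _ _ => 0).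
Proof.
move=> x Ax i; split; last exact: is_derive_cst.
have dl := linear_derive a x (ebase R i).
have -> : (fun y : V => \sum_i (y 0 i - c 0 i) * a i) =
    (fun y : V => \sum_i y 0 i * a i) - cst (\sum_i c 0 i * a i).
  by apply/funext => y /=; rewrite !fctE -sumrB; apply: eq_bigr => j _; ring.
apply: is_derive_eq; rewrite subr0 (bigD1 i) //= ebaseE eqxx mul1r big1 ?addr0 //.
by move=> j ji; rewrite ebaseE (negPf ji) mul0r.
Qed.

Lemma max_laplacian_le0 A f D D2 x : open A -> A x -> partials2 A f D D2 ->
  (exists2 e : R, 0 < e & forall y, `|y - x| < e -> f y <= f x) ->
  \sum_i D2 i x <= 0.
Proof.
move=> /openP oA Ax fD [e e0 fx]; have [d d0 dA] := oA x Ax.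
apply: sumr_le0 => i _.
have m0 : 0 < Num.min e d by rewrite lt_min e0.
apply: (@max_second_partials R n f D (D2^~ x) x _ m0 _ _ _ i).2.
- by move=> y; rewrite lt_min => /andP[ye _]; exact: fx.
- by move=> y; rewrite lt_min => /andP[_ yd] j; apply: (fD _ _ j).1; exact: dA.
- by move=> j; exact: (fD x Ax j).2.
Qed.

Section Barrier.
Variables (y : V) (r : R) (m : nat).
Let Q (x : V) := sqn (x - y).

(** A polynomial substitute for Hopf's exponential barrier: zero on the sphere of radius r about y,
    positive inside, and subharmonic on the outer annulus once m is large. *)
Definition barrier x := (2 * r ^+ 2 - Q x) ^+ m.+2 - (r ^+ 2) ^+ m.+2.
Definition barrier1 (i : 'I_n) x :=
  - (2 * m.+2%:R) * ((2 * r ^+ 2 - Q x) ^+ m.+1 * (x 0 i - y 0 i)).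
Definition barrier2 (i : 'I_n) x :=
  2 * m.+2%:R * (2 * r ^+ 2 - Q x) ^+ m *
    (2 * m.+1%:R * (x 0 i - y 0 i) ^+ 2 - (2 * r ^+ 2 - Q x)).

Lemma partials2_barrier A : partials2 A barrier barrier1 barrier2.
Proof.
move=> x _ i; have dQ := sqn_derive y x i.
have dP : is_derive x (ebase R i) (cst (2 * r ^+ 2) - Q) (- (2 * (x 0 i - y 0 i))).
  by apply: is_derive_eq; rewrite sub0r.
split.
  have -> : barrier = (cst (2 * r ^+ 2) - Q) ^+ m.+2 - cst ((r ^+ 2) ^+ m.+2).
    by apply/funext => w; rewrite /= !fctE.
  apply: is_derive_eq; rewrite subr0 /barrier1 /= !fctE /GRing.scale /=; ring.
have dc := coord_derive (y 0 i) x i.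
have -> : barrier1 i = (- (2 * m.+2%:R)) *:
    ((cst (2 * r ^+ 2) - Q) ^+ m.+1 * (fun w : V => w 0 i - y 0 i)).
  by apply/funext => w; rewrite /= !fctE.
apply: is_derive_eq; rewrite /barrier2 /= !fctE  /GRing.scale /= exprS; ring.
Qed.

Lemma barrier_laplacian x : \sum_i barrier2 i x =
  2 * m.+2%:R * (2 * r ^+ 2 - Q x) ^+ m *
    (2 * m.+1%:R * Q x - n%:R * (2 * r ^+ 2 - Q x)).
Proof.
rewrite -mulr_sumr; congr (_ * _).
rewrite sumrB -mulr_sumr sumr_const card_ord -[X in _ - X]mulr_natl.
by congr (_ * _ - _); rewrite /Q /sqn; apply: eq_bigr => i _; rewrite !mxE.
Qed.

End Barrier.

Lemma enorm_le_sqn x (r : R) : 0 <= r -> (enorm x <= r) = (sqn x <= r ^+ 2).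
Proof. by move=> r0; rewrite -sqr_enorm ler_pXn2r ?nnegrE ?enorm_ge0. Qed.

Lemma enorm_lt_sqn x (r : R) : 0 <= r -> (enorm x < r) = (sqn x < r ^+ 2).
Proof. by move=> r0; rewrite -sqr_enorm ltr_pXn2r ?nnegrE ?enorm_ge0. Qed.

Lemma closed_sqn_le (c : V) (a : R) : closed [set x | sqn (x - c) <= a].
Proof.
apply: (@preimage_closed V R (fun x => sqn (x - c)) [set t | t <= a]); last exact: closed_le.
by move=> x _; exact: sqn_continuous.
Qed.

Lemma closed_sqn_ge (c : V) (a : R) : closed [set x | a <= sqn (x - c)].
Proof.
apply: (@preimage_closed V R (fun x => sqn (x - c)) [set t | a <= t]); last exact: closed_ge.
by move=> x _; exact: sqn_continuous.
Qed.

Lemma open_sqn_lt (c : V) (a : R) : open [set x | sqn (x - c) < a].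
Proof.
apply: (@open_comp V R (fun x => sqn (x - c)) [set t | t < a]); last exact: open_lt.
by move=> x _; exact: sqn_continuous.
Qed.

Lemma open_sqn_gt (c : V) (a : R) : open [set x | a < sqn (x - c)].
Proof.
apply: (@open_comp V R (fun x => sqn (x - c)) [set t | a < t]); last exact: open_gt.
by move=> x _; exact: sqn_continuous.
Qed.

Lemma sqn_le_bounded (c : V) (a : R) x : sqn (x - c) <= a ->
  `|x| <= `|c| + Num.sqrt a.
Proof.
move=> xa; rewrite -{1}(subrK c x) addrC (le_trans (ler_normD _ _)) // lerD2l.
apply: le_trans (norm_le_enorm _) _; rewrite enormE ler_sqrt //.
exact: le_trans (sqn_ge0 _) xa.
Qed.

(** On the annulus between the radii r/2 and r, z + ep * eta is nonpositive on both bounding spheres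
    and has a positive Laplacian inside. It therefore has no positive maximum, so z <= - ep * eta <
    0 there. *)
Lemma harmonic_neg_grow A z D D2 y (r : R) : (0 < n)%N -> 0 < r -> open A ->
  (forall x, sqn (x - y) <= r ^+ 2 -> A x) ->
  (forall x, A x -> {for x, continuous z}) ->
  partials2 A z D D2 -> (forall x, A x -> \sum_i D2 i x = 0) ->
  (forall x, A x -> z x <= 0) ->
  (forall x, sqn (x - y) <= (r / 2) ^+ 2 -> z x < 0) ->
  forall x, sqn (x - y) < r ^+ 2 -> z x < 0.
Proof.
move=> n0 r0 oA KA cz zD zh z0 zin x xr.
have [xin|xout] := leP (sqn (x - y)) ((r / 2) ^+ 2); first exact: zin.
(* With q = |x - y|^2 between r^2 / 4 and r^2, m = 4 n makes 2 (m + 1) q exceed n (2 r^2 - q), the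
   sign condition for the Laplacian of the barrier. *)
pose m := (4 * n)%N; pose eta := barrier y r m.
have rr : 0 < r ^+ 2 by rewrite exprn_gt0.
have inA w : sqn (w - y) <= (r / 2) ^+ 2 -> A w.
  by move=> H; apply: KA; apply: le_trans H _; nra.
have [c cin cmax] : exists2 c, sqn (c - y) <= (r / 2) ^+ 2 &
    forall w, sqn (w - y) <= (r / 2) ^+ 2 -> z w <= z c.
  apply: (@evt_max R n [set w | sqn (w - y) <= (r / 2) ^+ 2] z).
  - by exists y; rewrite /= subrr sqn0 sqr_ge0.
  - exact: closed_sqn_le.
  - by move=> w; exact: sqn_le_bounded.
  - apply: continuous_in_subspaceT => w; rewrite inE /= => /inA; exact: cz.
have zc := zin c cin.
pose E := (2 * r ^+ 2) ^+ m.+2.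
have E0 : 0 < E by rewrite exprn_gt0 // mulr_gt0.
(* E bounds the barrier, so ep * eta <= - z c; this absorbs the barrier on the inner sphere, where z
   <= z c. *)
pose ep := - z c / E; have ep0 : 0 < ep by rewrite divr_gt0 // oppr_gt0.
pose phi w := z w + ep * eta w.
suff phi0 : phi x <= 0.
  have : 0 < ep * eta x.
    rewrite mulr_gt0 // subr_gt0 ltr_pXn2r // ?nnegrE ?(ltW rr) //; first by lra.
    by lra.
  by rewrite /phi in phi0; lra.
rewrite leNgt; apply/negP => phix.
pose K := [set w : V | (r / 2) ^+ 2 <= sqn (w - y)] `&` [set w | sqn (w - y) <= r ^+ 2].
have phiD : partials2 A phi (fun i w => D i w + ep * barrier1 y r m i w)
    (fun i w => D2 i w + ep * barrier2 y r m i w).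
  by apply: partials2D => //; apply: partials2Z; exact: partials2_barrier.
have cphi w : A w -> {for w, continuous phi}.
  move=> Aw; apply: continuous_atD; first exact: cz.
  apply: continuous_atM; first exact: continuous_at_cst.
  apply: continuous_atD; last exact: continuous_at_cst.
  apply/continuous_atX/continuous_atD; first exact: continuous_at_cst.
  by apply: continuous_atN; exact: sqn_continuous.
have [x0 [x0l x0r] x0max] : exists2 c, K c & forall w, K w -> phi w <= phi c.
  apply: (@evt_max R n K phi).
  - by exists x; split; exact: ltW.
  - by apply: closedI; [exact: closed_sqn_ge|exact: closed_sqn_le].
  - by move=> w [_]; exact: sqn_le_bounded.
  - by apply: continuous_in_subspaceT => w; rewrite inE => -[_ /KA]; exact: cphi.
have phix0 : 0 < phi x0 by apply: lt_le_trans phix (x0max _ _); split; exact: ltW.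
have Ax0 : A x0 by exact: KA.
have {}x0r : sqn (x0 - y) < r ^+ 2.
  rewrite lt_neqAle x0r andbT; apply: contraTneq phix0 => E1.
  rewrite -leNgt /phi /eta /barrier E1 (_ : 2 * r ^+ 2 - r ^+ 2 = r ^+ 2); last by ring.
  by rewrite subrr mulr0 addr0 z0.
have {}x0l : (r / 2) ^+ 2 < sqn (x0 - y).
  rewrite lt_neqAle x0l andbT; apply: contraTneq phix0 => E1.
  rewrite -leNgt /phi.
  have etaE : eta x0 <= E.
    rewrite /eta /barrier (le_trans (_ : _ <= (2 * r ^+ 2 - sqn (x0 - y)) ^+ m.+2)) //.
      by rewrite gerBl exprn_ge0 // ltW.
    by rewrite ler_pXn2r ?nnegrE //; have := sqn_ge0 (x0 - y); lra.
  have := cmax x0; rewrite -E1 lexx => /(_ isT) zx0.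
  have : ep * eta x0 <= - z c by rewrite /ep mulrAC ler_pdivrMr // ler_wpM2l // oppr_ge0 ltW.
  by lra.
have : \sum_i (D2 i x0 + ep * barrier2 y r m i x0) <= 0.
  apply: (max_laplacian_le0 oA Ax0 phiD).
  have oK : open ([set w | (r / 2) ^+ 2 < sqn (w - y)] `&`
      [set w : V | sqn (w - y) < r ^+ 2]).
    by apply: openI; [exact: open_sqn_gt|exact: open_sqn_lt].
  have [d d0 dK] := (iffLR (openP _)) oK x0 (conj x0l x0r).
  by exists d => // w /dK[/= H1 H2]; apply: x0max; split; exact: ltW.
rewrite big_split /= zh // add0r -mulr_sumr pmulr_rle0 // barrier_laplacian.
rewrite leNgt => /negP; apply.
have q1 : 0 < 2 * r ^+ 2 - sqn (x0 - y) by lra.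
rewrite mulr_gt0 ?mulr_gt0 ?exprn_gt0 // subr_gt0.
have N0 : 1 <= n%:R :> R by rewrite ler1n.
have -> : m.+1%:R = 4 * n%:R + 1 :> R by rewrite /m -[LHS]natr1 natrM.
move: x0l x0r q1; move: (sqn (x0 - y)) => q.
rewrite expr_div_n => ? ? ?; nra.
Qed.

(** If z y < 0, negativity propagates to p along a chain of balls centred on the segment from y to
    p: [harmonic_neg_grow] doubles the radius r/2, and the doubled ball contains the next small
    one. *)
Lemma harmonic_strong_max p (s : R) z D D2 : (0 < n)%N ->
  let B := [set x : V | sqn (x - p) < s ^+ 2] in
  (forall x, B x -> {for x, continuous z}) ->
  partials2 B z D D2 -> (forall x, B x -> \sum_i D2 i x = 0) ->
  (forall x, B x -> z x <= 0) -> 0 < s -> z p = 0 ->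
  forall x, B x -> z x = 0.
Proof.
move=> n0 B cz zD zh z0 s0 zp y By; apply/eqP; rewrite eq_le z0 //= leNgt.
apply/negP => zy.
have ys : enorm (y - p) < s by rewrite enorm_lt_sqn // ltW.
have zy' : 0 < - z y by rewrite oppr_gt0.
have [d d0 dz] := (iffLR (continuous_atP _ _)) (cz y By) (- z y) zy'.
(* z is negative on the first ball by continuity, and every ball of radius r centred on the segment
   lies in B. *)
pose r := Num.min d (s - enorm (y - p)) / 2.
have m0 : 0 < Num.min d (s - enorm (y - p)) by rewrite lt_min d0 subr_gt0.
have r0 : 0 < r by rewrite divr_gt0.
have r20 : 0 <= r / 2 by rewrite ltW // divr_gt0.
have rd : r < d by have := ge_min d d (s - enorm (y - p)); rewrite lexx /= /r; lra.
have rs : enorm (y - p) + r < s.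
  by have := ge_min (s - enorm (y - p)) d (s - enorm (y - p)); rewrite lexx orbT /r; lra.
pose l := enorm (p - y).
(* K + 1 steps bring consecutive centres closer than r/2. *)
have [K lK] : exists K : nat, l < K.+1%:R * (r / 2).
  exists (Num.truncn (l / (r / 2))); rewrite -ltr_pdivrMr ?divr_gt0 //.
  exact: truncnS_gt.
pose c k : V := y + (k%:R / K.+1%:R) *: (p - y).
have cB k : (k <= K.+1)%N -> forall x, sqn (x - c k) <= r ^+ 2 -> B x.
  move=> kK x; rewrite -enorm_le_sqn ?(ltW r0) // => xc.
  rewrite /B /= -enorm_lt_sqn ?(ltW s0) //.
  have -> : x - p = (x - c k) + (1 - k%:R / K.+1%:R) *: (y - p).
    by apply/rowP => i; rewrite !mxE; ring.
  apply: le_lt_trans (enormD _ _) _; rewrite enormZ.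
  have k01 : `|1 - k%:R / K.+1%:R| <= 1 :> R.
    have ? : 0 <= k%:R / K.+1%:R :> R by rewrite divr_ge0.
    have ? : k%:R / K.+1%:R <= 1 :> R by rewrite ler_pdivrMr ?ltr0n // mul1r ler_nat.
    by rewrite ger0_norm ?subr_ge0 // gerBl.
  apply: le_lt_trans (_ : r + 1 * enorm (y - p) < _); last by rewrite mul1r addrC.
  by apply: lerD => //; rewrite ler_wpM2r // enorm_ge0.
have step k : (k <= K.+1)%N -> forall x, sqn (x - c k) <= (r / 2) ^+ 2 -> z x < 0.
  elim: k => [_ x|k IH kK x].
    rewrite /c mul0r scale0r addr0 -(enorm_le_sqn _ r20) => xy.
    have /dz : `|x - y| < d by apply: le_lt_trans (norm_le_enorm _) _; lra.
    by rewrite ltr_norml => /andP[_]; lra.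
  rewrite -(enorm_le_sqn _ r20) => xc.
  have := @harmonic_neg_grow B z D D2 (c k) r n0 r0 (@open_sqn_lt p (s ^+ 2))
    (cB k (ltnW kK)) cz zD zh z0 (IH (ltnW kK)) x.
  apply; rewrite -enorm_lt_sqn ?(ltW r0) //.
  have -> : x - c k = (x - c k.+1) + (K.+1%:R)^-1 *: (p - y).
    by rewrite /c -[in RHS](natr1 k); apply/rowP => i; rewrite !mxE; ring.
  apply: le_lt_trans (enormD _ _) _; rewrite enormZ gtr0_norm ?invr_gt0 ?ltr0n //.
  have : K.+1%:R^-1 * enorm (p - y) < r / 2 by rewrite mulrC ltr_pdivrMr ?ltr0n // mulrC.
  by move=> H; rewrite [ltRHS]splitr ler_ltD.
have := step K.+1 (leqnn _) p.
have -> : c K.+1 = p by rewrite /c mulfV ?pnatr_eq0 // scale1r addrC subrK.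
by rewrite subrr sqn0 sqr_ge0 zp ltxx => /(_ isT).
Qed.

End Harmonic.

(** * A maximum principle for expressions with first derivatives *)

Section Dilation.
Variables (R : realType) (n : nat).
Local Notation V := 'rV[R]_n.
Implicit Types (A : set V) (x y p : V).

Lemma locally_bounded (I : finType) (f : I -> V -> R) p :
  (forall k, {for p, continuous (f k)}) ->
  exists e L : R, 0 < e /\ forall k x, `|x - p| < e -> `|f k x| <= L.
Proof.
move=> cf.
have /choice[d dP] : forall k, exists d : R, 0 < d /\
    forall x, `|x - p| < d -> `|f k x - f k p| < 1.
  by move=> k; have [d d0 H] := (iffLR (continuous_atP _ _)) (cf k) 1 ltr01; exists d.
exists (\big[Num.min/1]_k d k), (\sum_k `|f k p| + 1); split.
  by apply/bigmin_gtP; split => // k _; case: (dP k).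
move=> k x xd; have /ltW : `|f k x - f k p| < 1.
  by apply: (dP k).2; apply: lt_le_trans xd _; exact: bigmin_le_cond.
move=> H; rewrite -(subrK (f k p) (f k x)) addrC (le_trans (ler_normD _ _)) // lerD //.
by rewrite (bigD1 k) //= lerDl sumr_ge0.
Qed.

Lemma dotp_le (a : V) (v : 'I_n -> R) (M : R) : (forall i, `|v i| <= M) ->
  `|\sum_i a 0 i * v i| <= n%:R * (`|a| * M).
Proof.
move=> vM; apply: le_trans (ler_norm_sum _ _ _) _.
apply: le_trans (_ : \sum_(i < n) `|a| * M <= _); last first.
  by rewrite sumr_const card_ord mulr_natl.
by apply: ler_sum => i _; rewrite normrM ler_pM // coord_le_norm.
Qed.

Variables (A : set V) (w : V -> R) (W : 'I_n -> V -> R) (WW : 'I_n -> 'I_n -> V -> R).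
Hypothesis oA : open A.
Hypothesis wW : forall x, A x -> forall i, is_derive x (ebase R i) w (W i x).
Hypothesis cw : forall x, A x -> {for x, continuous w}.
Hypothesis cW : forall x, A x -> forall i, {for x, continuous (W i)}.
Hypothesis wWW : forall x, A x -> forall i j, is_derive x (ebase R j) (W i) (WW i j x).
Hypothesis cWW : forall x, A x -> forall i j, {for x, continuous (WW i j)}.
Hypothesis harm : forall x, A x -> \sum_i WW i i x = 0.

Lemma total_derive_in x (v : V) : A x -> is_derive x v w (\sum_i v 0 i * W i x).
Proof.
move=> Ax; have [d d0 dA] := (iffLR (openP _)) oA x Ax.
by apply: (total_derive _ d0) => [y /dA|i]; [exact: wW|exact: cW].
Qed.

(* The increment quotient of the dilation [(1 + t) w (x + t (b - (x - p)))] in [t]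
   is exactly harmonic in [x], and tends to
   [\sum_i (b - (x - p)) 0 i * W i x + w x] uniformly near [p]. The limit thus
   obeys the maximum principle although it involves first derivatives of the
   merely twice differentiable [w]. *)
Lemma dilation_no_max p (b c : V) (dl : R) : (0 < n)%N -> A p -> 0 < dl ->
  ~ (exists2 e : R, 0 < e & forall x, `|x - p| < e ->
      \sum_i (b - (x - p)) 0 i * W i x + w x + \sum_i (x 0 i - p 0 i) * c 0 i +
        dl * sqn (x - p)
      <= \sum_i b 0 i * W i p + w p).
Proof.
move=> n0 Ap dl0 [e0 e00 Hmax].
have [eA eA0 eAP] := (iffLR (openP _)) oA p Ap.
have [e1 [L1 [e10 HL1]]] := locally_bounded (cW Ap).
have [e2 [L2 [e20 HL2]]] := @locally_bounded _ (fun k : 'I_n * 'I_n => WW k.1 k.2) p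
  (fun k => @cWW p Ap k.1 k.2).
pose e := Num.min (Num.min e0 eA) (Num.min e1 e2).
have e_gt0 : 0 < e by rewrite !lt_min e00 eA0 e10.
have inA x : `|x - p| < e -> A x by rewrite !lt_min => /andP[/andP[_ /eAP]].
have bW x i : `|x - p| < e -> `|W i x| <= L1.
  by rewrite !lt_min => /andP[_ /andP[? _]]; exact: HL1.
have bWW x i j : `|x - p| < e -> `|WW i j x| <= L2.
  by rewrite !lt_min => /andP[_ /andP[_ ?]]; exact: (HL2 (i, j)).
have maxH x : `|x - p| < e -> `|x - p| < e0 by rewrite !lt_min => /andP[/andP[]].
have L10 : 0 <= L1 by apply: le_trans (HL1 (Ordinal n0) p _); rewrite ?subrr ?normr0.
have L20 : 0 <= L2.
  by apply: le_trans (HL2 (Ordinal n0, Ordinal n0) p _); rewrite ?subrr ?normr0.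
pose a x : V := b - (x - p).
pose H x := \sum_i a x 0 i * W i x + w x.
(* Since a x is affine in x with linear part -1, x + t a x is a dilation by 1 - t in x, and
   composition with it preserves harmonicity. *)
pose q (t : R) x := t *: (b + p) + (1 - t) *: x.
have qE t x : q t x = x + t *: a x.
  by apply/rowP => i; rewrite !mxE; ring.
pose Ht (t : R) x := t^-1 * ((1 + t) * w (q t x) - w x).
pose rho := e / 2; pose al := `|b| + rho + 1.
have rho0 : 0 < rho by rewrite divr_gt0.
have al0 : 0 < al by rewrite /al; have := normr_ge0 b; lra.
(* The first summand bounds the variation of the gradient W along the displacement t a x, through
   L2; the second bounds the increment of w itself, through L1. *)
pose C := n%:R * (al * (n%:R * (L2 * al))) + n%:R * (L1 * al).
have C0 : 0 <= C by rewrite addr_ge0 // !mulr_ge0 // ltW.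
have close t x : 0 < t -> t * al < rho -> `|x - p| <= rho -> `|Ht t x - H x| <= C * t.
  move=> t0 tal xr; have tn : t != 0 by rewrite gt_eqF.
  have aal : `|a x| <= al.
    by rewrite /a /al (le_trans (ler_normB _ _)) //; lra.
  have ta : `|t *: a x| <= t * al by rewrite normrZ gtr0_norm // ler_pM2l.
  have seg (s : R) : 0 <= s <= 1 -> `|x + s *: (t *: a x) - p| < e.
    move=> /andP[s0 s1]; rewrite addrAC (le_lt_trans (ler_normD _ _)) //.
    have : `|s *: (t *: a x)| <= `|t *: a x|.
      by rewrite [leLHS]normrZ ger0_norm // ler_piMl.
    have := splitr e; rewrite -/rho; lra.
  have xe : `|x - p| < e by have := seg 0; rewrite scale0r addr0 lexx ler01; exact.
  have qe : `|q t x - p| < e by have := seg 1; rewrite scale1r -qE lexx ler01; exact.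
  have [s s01|s s01 E] := @line_mean_value R _ w x (t *: a x)
      (fun s => \sum_i (t *: a x) 0 i * W i (x + s *: (t *: a x))).
    by apply: total_derive_in; apply: inA; exact: seg.
  have {}E : w (q t x) - w x = t * \sum_i a x 0 i * W i (x + s *: (t *: a x)).
    by rewrite qE E mulr_sumr; apply: eq_bigr => i _; rewrite mxE mulrA.
  have -> : Ht t x - H x =
      \sum_i a x 0 i * (W i (x + s *: (t *: a x)) - W i x) + (w (q t x) - w x).
    transitivity (t^-1 * (w (q t x) - w x) + w (q t x) - H x).
      by rewrite /Ht; field.
    rewrite {1}E mulrA mulVf // mul1r /H.
    under [in RHS]eq_bigr do rewrite mulrBr.
    by rewrite sumrB; ring.
  rewrite (le_trans (ler_normD _ _)) // /C mulrDl lerD //.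
    have Wlip i : `|W i (x + s *: (t *: a x)) - W i x| <= n%:R * (L2 * (t * al)).
      have := @coordinate_lipschitz R n (W i) (WW i) p e L2 _ x _ xe (seg s s01).
      move=> /(_ (fun y ye j => conj (wWW (inA y ye) i j) (bWW y i j ye))).
      move=> /le_trans; apply; rewrite ler_wpM2l // ler_wpM2l // addrC addKr.
      apply: le_trans ta; rewrite [leLHS]normrZ ler_piMl //.
      by case/andP: s01 => s0 s1; rewrite ger0_norm.
    apply: le_trans (dotp_le (a x) Wlip) _.
    have -> : n%:R * (al * (n%:R * (L2 * al))) * t = n%:R * (al * (n%:R * (L2 * (t * al)))).
      by ring.
    rewrite ler_wpM2l // ler_wpM2r // !mulr_ge0 // ltW //.
  have := @coordinate_lipschitz R n w W p e L1 _ x _ xe qe.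
  move=> /(_ (fun y ye j => conj (wW (inA y ye) j) (bW y j ye))).
  move=> /le_trans; apply; rewrite -!mulrA ler_wpM2l // ler_wpM2l // [al * t]mulrC.
  by rewrite qE addrC addKr.
(* t keeps the dilated points in the cube of radius e, keeps 1 - t positive, and makes twice the
   approximation error C t smaller than dl / 2 * rho^2. *)
pose t := Num.min (Num.min (rho / al) 1) (dl * rho ^+ 2 / (4 * (C + 1))) / 2.
have C1 : 0 < C + 1 by rewrite ltr_wpDl.
have m0 : 0 < Num.min (Num.min (rho / al) 1) (dl * rho ^+ 2 / (4 * (C + 1))).
  by rewrite !lt_min divr_gt0 // ltr01 divr_gt0 // ?mulr_gt0 // exprn_gt0.
have t0 : 0 < t by rewrite divr_gt0.
have : t < Num.min (Num.min (rho / al) 1) (dl * rho ^+ 2 / (4 * (C + 1))).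
  by rewrite /t ltr_pdivrMr // ltr_pMr // ltr1n.
rewrite !lt_min => /andP[/andP[]].
rewrite ltr_pdivlMr // => tal t1; rewrite ltr_pdivlMr ?mulr_gt0 // => tC.
have {tC} Ct : 2 * (C * t) < dl / 2 * rho ^+ 2 by nra.
pose l x := \sum_i (x 0 i - p 0 i) * c 0 i.
(* Only half of dl is kept. The other half lowers psi on the sphere of radius rho by more than the
   two approximation errors, so psi has an interior maximum; but its Laplacian is dl * n > 0. *)
pose psi x := Ht t x + l x + dl / 2 * sqn (x - p).
have rhoP x : sqn (x - p) <= rho ^+ 2 -> `|x - p| <= rho.
  by rewrite -(enorm_le_sqn _ (ltW rho0)); apply: le_trans; exact: norm_le_enorm.
have ltP x : `|x - p| <= rho -> `|x - p| < e.
  by move=> /le_lt_trans; apply; rewrite /rho ltr_pdivrMr // ltr_pMr // ltr1n.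
have qA x : `|x - p| <= rho -> A (q t x).
  move=> xr; apply: inA; rewrite qE addrAC (le_lt_trans (ler_normD _ _)) //.
  have : `|t *: a x| <= t * al.
    rewrite normrZ gtr0_norm // ler_pM2l //.
    by rewrite /a /al (le_trans (ler_normB _ _)) //; lra.
  by have := splitr e; rewrite -/rho; lra.
have cpsi x : `|x - p| <= rho -> {for x, continuous psi}.
  move=> xr; have cx := cw (inA x (ltP x xr)).
  have cq : {for x, continuous (fun y => w (q t y))}.
    apply/continuous_atP => ep ep0.
    have [d d0 dP] := (iffLR (continuous_atP _ _)) (cw (qA x xr)) ep ep0.
    exists d => // y yx; apply: dP; apply: le_lt_trans yx.
    rewrite /q opprD addrACA subrr add0r -scalerBr normrZ ler_piMl //.
    by rewrite ger0_norm; lra.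
  apply: continuous_atD; [apply: continuous_atD|].
  - apply: continuous_atM; first exact: continuous_at_cst.
    apply: continuous_atD; last exact: continuous_atN.
    by apply: continuous_atM => //; exact: continuous_at_cst.
  - apply: (continuous_sum (f := fun i y => (y 0 i - p 0 i) * c 0 i)) => i y.
    rewrite -[continuous_at _ _]/{for y, continuous _}.
    apply: continuous_atM; last exact: continuous_at_cst.
    apply: continuous_atD; last exact: continuous_at_cst.
    exact: coord_continuous.
  - by apply: continuous_atM; [exact: continuous_at_cst|exact: sqn_continuous].
have [x1 x1r x1max] : exists2 c, sqn (c - p) <= rho ^+ 2 &
    forall x, sqn (x - p) <= rho ^+ 2 -> psi x <= psi c.
  apply: (@evt_max R n [set x | sqn (x - p) <= rho ^+ 2] psi).
  - by exists p; rewrite /= subrr sqn0 sqr_ge0.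
  - exact: closed_sqn_le.
  - by move=> x; exact: sqn_le_bounded.
  - apply: continuous_in_subspaceT => x; rewrite inE /= => /rhoP; exact: cpsi.
have Hp : H p = \sum_i b 0 i * W i p + w p.
  by congr (_ + _); apply: eq_bigr => i _; rewrite /a subrr subr0.
have psip : H p - C * t <= psi p.
  have := close t p t0 tal; rewrite subrr normr0 => /(_ (ltW rho0)).
  rewrite ler_norml => /andP[+ _]; rewrite /psi subrr sqn0 mulr0 addr0.
  have -> : l p = 0 by rewrite /l big1 // => i _; rewrite subrr mul0r.
  by lra.
have {}x1r : sqn (x1 - p) < rho ^+ 2.
  rewrite lt_neqAle x1r andbT; apply/eqP => E.
  have := x1max p; rewrite subrr sqn0 sqr_ge0 => /(_ isT).
  have x1rho := rhoP x1 x1r.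
  have := close t x1 t0 tal x1rho; rewrite ler_norml => /andP[_].
  have := Hmax x1 (maxH _ (ltP _ x1rho)); rewrite -Hp -/(a x1) -/(H x1) -/(l x1).
  rewrite [psi x1]/psi E; move: (rho ^+ 2) (C * t) psip Ct => r2 ct; lra.
have xU x : sqn (x - p) < rho ^+ 2 -> `|x - p| <= rho by move=> /ltW /rhoP.
have psiD : partials2 [set x | sqn (x - p) < rho ^+ 2] psi
   (fun i x => t^-1 * ((1 + t) * ((1 - t) * W i (q t x)) + (- 1) * W i x) + c 0 i
      + dl / 2 * (2 * (x 0 i - p 0 i)))
   (fun i x => t^-1 * ((1 + t) * ((1 - t) * ((1 - t) * WW i i (q t x))) + (- 1) * WW i i x)
      + 0 + dl / 2 * 2).
  apply: partials2D; [apply: partials2D|].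
  - have -> : Ht t = (fun x => t^-1 * ((1 + t) * w (q t x) + (- 1) * w x)).
      by apply/funext => x; rewrite /Ht mulN1r.
    apply: partials2Z; apply: partials2D; apply: partials2Z.
      move=> x /xU /qA Aq i; split; first exact/is_derive_affine/wW.
      have := is_derive_affine (wWW Aq i i) => /(is_deriveZ (1 - t)); exact.
    by move=> x /xU /ltP /inA Ax i; split; [exact: wW|exact: wWW].
  - exact: partials2_coord.
  - by apply: partials2Z; exact: partials2_sqn.
have := max_laplacian_le0 (@open_sqn_lt R n p (rho ^+ 2)) x1r psiD.
have -> : \sum_i (t^-1 * ((1 + t) * ((1 - t) * ((1 - t) * WW i i (q t x1))) +
    (- 1) * WW i i x1) + 0 + dl / 2 * 2) = dl * n%:R.
  rewrite 2!big_split /= -mulr_sumr big_split /= -!mulr_sumr.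
  rewrite (harm (qA _ (xU _ x1r))) (harm (inA _ (ltP _ (xU _ x1r)))).
  rewrite big1 // (_ : \sum_(i < n) 2 = 2 * n%:R); last first.
    by rewrite sumr_const card_ord mulr_natr.
  by rewrite !mulr0 !addr0 !mulr0 add0r mulrA divfK.
move=> /(_ _) K; have : dl * n%:R <= 0.
  apply: K; have [d d0 dU] := (iffLR (openP _)) (@open_sqn_lt R n p (rho ^+ 2)) x1 x1r.
  by exists d => // y /dU /ltW; exact: x1max.
by rewrite leNgt mulr_gt0 // ltr0n.
Qed.

End Dilation.

(** * Solutions of the Serrin problem *)

Section Serrin.
Variables (R : realType) (n : nat) (Om : set 'rV[R]_n) (u : 'rV[R]_n -> R).
Variables (g : 'I_n -> 'rV[R]_n -> R) (N : set 'rV[R]_n).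
Local Notation V := 'rV[R]_n.
Implicit Types (x y p q : V).
Hypothesis n3 : (3 <= n)%N.
Hypothesis oOm : open Om.
Hypothesis cOm : connected Om.
Hypothesis Om0 : Om !=set0.
Hypothesis bOm : bounded_dom Om.
Hypothesis sol : serrin_solution Om u g.
Hypothesis CN : components (Om `\` MAX Om u) N.

Local Notation D i := (partial i u).
Local Notation DD i j := (partial j (partial i u)).
Local Notation um := (umax Om u).

Let n0 : (0 < n)%N. Proof. exact: leq_trans n3. Qed.
Let nr0 : 0 < n%:R :> R. Proof. by rewrite ltr0n. Qed.

Lemma sol_continuous x : Om x -> {for x, continuous u}.
Proof. by case: sol => -[H _] _ _ _ _; exact: H. Qed.

Lemma sol_derive x i : Om x -> is_derive x (ebase R i) u (D i x).
Proof. by case: sol => -[_ H] _ _ _ _ Ox; apply: derivableP; exact: (H i).1. Qed.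

Lemma sol_D_continuous x i : Om x -> {for x, continuous (D i)}.
Proof. by case: sol => -[_ H] _ _ _ _ Ox; exact: (H i).2.1. Qed.

Lemma sol_derive2 x i j : Om x -> is_derive x (ebase R j) (D i) (DD i j x).
Proof. by case: sol => -[_ H] _ _ _ _ Ox; apply: derivableP; exact: ((H i).2.2 j).1. Qed.

Lemma sol_DD_continuous x i j : Om x -> {for x, continuous (DD i j)}.
Proof. by case: sol => -[_ H] _ _ _ _ Ox; exact: ((H i).2.2 j).2. Qed.

Lemma sol_laplacian x : Om x -> \sum_i DD i i x = - n%:R.
Proof. by case: sol => _ _ _ H _; exact: H. Qed.

Lemma sol_partials2 : partials2 Om u (fun i => D i) (fun i => DD i i).
Proof. by move=> x Ox i; split; [exact: sol_derive|exact: sol_derive2]. Qed.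

Lemma closure_bounded : exists M : R, forall x, closure Om x -> `|x| <= M.
Proof.
case: bOm => M HM; exists (M + 1) => x /closureP /(_ 1 ltr01)[y Oy yx].
rewrite -(subrK y x) addrC (le_trans (ler_normD _ _)) // lerD //.
  exact: le_trans (norm_le_enorm y) (HM y Oy).
by rewrite distrC ltW.
Qed.

Lemma bd_disjoint x : bd Om x -> ~ Om x.
Proof. by case. Qed.

Lemma closure_split x : closure Om x -> Om x \/ bd Om x.
Proof. by move=> cx; have [Ox|Ox] := pselect (Om x); [left|right; split]. Qed.

(** The Laplacian of -u is n > 0, which is impossible at a local maximum of -u. *)
Lemma sol_no_local_min x (e : R) : Om x -> 0 < e ->
  ~ (forall y, `|y - x| < e -> u x <= u y).
Proof.
move=> Ox e0 H.
have := @max_laplacian_le0 R n Om _ _ _ x oOm Ox (partials2Z (-1) sol_partials2).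
rewrite -mulr_sumr sol_laplacian // [X in X <= 0]mulN1r opprK => K.
have : n%:R <= 0 :> R.
  by apply: K; exists e => // y /H; rewrite !mulN1r lerN2.
by rewrite leNgt nr0.
Qed.

Lemma sol_pos x : Om x -> 0 < u x.
Proof.
move=> Ox; have [M HM] := closure_bounded; case: (sol) => _ cu u0 _ _.
have [c cc cmin] : exists2 c, closure Om c &
    forall y, closure Om y -> - u y <= - u c.
  apply: (@evt_max R n _ (fun y => - u y) M) => //.
  - by exists x; exact: subset_closure.
  - exact: closed_closure.
  - by move=> y; apply: continuous_atN; exact: cu.
have nOm y : Om y -> u c < u y.
  move=> Oy; have := cmin y (subset_closure Oy); rewrite lerN2 le_eqVlt.
  case/predU1P => // E; exfalso.
  have [d d0 dO] := (iffLR (openP _)) oOm y Oy.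
  apply: (sol_no_local_min Oy d0) => z /dO Oz.
  by have := cmin z (subset_closure Oz); rewrite lerN2 E.
have [Oc|bc] := closure_split cc; first by have := nOm c Oc; rewrite ltxx.
by have := nOm x Ox; rewrite (u0 c).
Qed.

Lemma max_point : exists2 c, MAX Om u c & forall y, closure Om y -> u y <= um.
Proof.
have [M HM] := closure_bounded; case: (sol) => _ cu u0 _ _.
have [x Ox] := Om0.
have [c cc cmax] : exists2 c, closure Om c & forall y, closure Om y -> u y <= u c.
  apply: (@evt_max R n _ u M) => //; last exact: closed_closure.
  by exists x; exact: subset_closure.
have Oc : Om c.
  have [//|bc] := closure_split cc.
  have := cmax x (subset_closure Ox); rewrite (u0 c) // => ux.
  by have := lt_le_trans (sol_pos Ox) ux; rewrite ltxx.
have E : um = u c.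
  apply/eqP; rewrite eq_le; apply/andP; split.
    apply: ge_sup; first by exists (u c), c.
    by move=> _ [y Oy <-]; apply: cmax; exact: subset_closure.
  apply: ub_le_sup; last by exists c.
  by exists (u c) => _ [y Oy <-]; apply: cmax; exact: subset_closure.
by exists c => [|y cy]; rewrite ?E //; exact: cmax.
Qed.

Lemma le_umax y : closure Om y -> u y <= um.
Proof. by have [c _] := max_point; exact. Qed.

Lemma umax_gt0 : 0 < um.
Proof. by have [c [Oc <-] _] := max_point; exact: sol_pos. Qed.

Lemma MAX_grad x i : MAX Om u x -> D i x = 0.
Proof.
move=> [Ox ux]; have [d d0 dO] := (iffLR (openP _)) oOm x Ox.
apply: (@max_second_partials R n u (fun i => D i) (fun i => DD i i x) x d d0 _ _ _ i).1.
- by move=> y /dO Oy; rewrite ux; apply: le_umax; exact: subset_closure.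
- by move=> y /dO Oy j; exact: sol_derive.
- by move=> j; exact: sol_derive2.
Qed.

(** * The component [N] and its closure *)

Let W := Om `\` MAX Om u.

Lemma offmaxE x : W x <-> Om x /\ u x < um.
Proof.
split => [[Ox H]|[Ox H]]; split => //; last by move=> [_ E]; rewrite E ltxx in H.
rewrite lt_neqAle (le_umax (subset_closure Ox)) andbT.
by apply/eqP => E; apply: H.
Qed.

Lemma offmax_open : open W.
Proof.
apply/openP => x /offmaxE[Ox ux].
have [d d0 dO] := (iffLR (openP _)) oOm x Ox.
have e0 : 0 < um - u x by rewrite subr_gt0.
have [d' d'0 du] := (iffLR (continuous_atP _ _)) (sol_continuous Ox) _ e0.
exists (Num.min d d'); first by rewrite lt_min d0.
move=> y; rewrite lt_min => /andP[/dO Oy /du]; rewrite ltr_norml => /andP[_ H].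
by apply/offmaxE; split => //; lra.
Qed.

Lemma comp_open : open N.
Proof. exact: component_open offmax_open CN. Qed.

Lemma comp_sub x : N x -> Om x /\ u x < um.
Proof. by move=> /(component_sub CN) /offmaxE. Qed.

Lemma closure_comp_sub x : closure N x -> closure Om x.
Proof. by apply: closureS => y /comp_sub[]. Qed.

Lemma closure_comp x : closure N x -> [\/ N x, MAX Om u x | bd Om x].
Proof.
move=> cx; have [Ox|bx] := closure_split (closure_comp_sub cx); last exact: Or33.
have [Mx|Mx] := pselect (MAX Om u x); first exact: Or32.
by apply: Or31; apply: component_rel_closed offmax_open CN cx _.
Qed.

Lemma within_closure_comp (f : V -> R) : {within closure Om, continuous f} ->
  {within closure N, continuous f}.
Proof. by apply: continuous_subspaceW => x; exact: closure_comp_sub. Qed.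

(** A minimum point of u over the closure of N is not in N, where u has no local minimum, nor in the
    maximum set, since u < um on N. *)
Lemma bd_comp_nonempty : (bd Om `&` closure N) !=set0.
Proof.
have [M HM] := closure_bounded; case: (sol) => _ cu u0 _ _.
have [x Nx] := component_nonempty CN.
have [c cc cmin] : exists2 c, closure N c & forall y, closure N y -> - u y <= - u c.
  apply: (@evt_max R n _ (fun y => - u y) M) => //.
  - by exists x; exact: subset_closure.
  - exact: closed_closure.
  - by move=> y /closure_comp_sub; exact: HM.
  - by move=> y; apply: continuous_atN; exact: within_closure_comp.
have [Nc|[_ Ec]|bc] := closure_comp cc; last by exists c.
  exfalso; have [d d0 dN] := (iffLR (openP _)) comp_open c Nc.
  apply: (@sol_no_local_min c d) => // [|y /dN Ny]; first by case: (comp_sub Nc).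
  by rewrite -lerN2; apply: cmin; exact: subset_closure.
have := cmin x (subset_closure Nx); rewrite lerN2 Ec leNgt.
by case: (comp_sub Nx) => _ ->.
Qed.

(** Otherwise N would be open and relatively closed in Om, hence all of Om, which contains a maximum
    point. *)
Lemma MAX_comp_nonempty : exists2 q, MAX Om u q & closure N q.
Proof.
apply: contrapT => H.
have NE : N = Om.
  apply: connected_clopen cOm (component_nonempty CN) _ comp_open _.
    by move=> x /comp_sub[].
  move=> x cx Ox; have [//|Mx|bx] := closure_comp cx.
    by exfalso; apply: H; exists x.
  by have := bd_disjoint bx.
have [c [Oc Ec] _] := max_point.
by move: (Oc); rewrite -{1}NE => /comp_sub[_]; rewrite Ec ltxx.
Qed.

Lemma coord_derive_dir (c : R) x i j :
  is_derive x (ebase R j) (fun y : V => y 0 i - c) (i == j)%:R.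
Proof.
apply/is_deriveP => e e0; exists 1 => // h _.
rewrite !mxE eqxx /= (_ : _ - _ - _ = 0) ?normr0 ?(mulr_ge0 (ltW e0)) //; ring.
Qed.

(** * Rigidity when the boundary gradient is at most sqrt(2 um) *)

Section Gradient.
Hypothesis bdg : forall x, bd Om x -> closure N x -> \sum_i g i x ^+ 2 <= 2 * um.

Lemma gradient_bound x : N x -> \sum_i D i x ^+ 2 + 2 * u x <= 2 * um.
Proof.
move=> Nx; rewrite leNgt; apply/negP => Px.
have [M HM] := closure_bounded; case: (sol) => _ cu u0 _ cg.
have gD y i : Om y -> g i y = D i y by exact: (cg i).2.
pose P y := \sum_i g i y ^+ 2 + 2 * u y.
pose B := n%:R * M ^+ 2.
have HB y : closure N y -> sqn y <= B.
  move=> /closure_comp_sub /HM yM; apply: le_trans (sqn_le y) _.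
  by rewrite ler_wpM2l // ler_pXn2r ?nnegrE // (le_trans _ yM).
have B0 : 0 <= B by exact: le_trans (sqn_ge0 x) (HB x (subset_closure Nx)).
(* The perturbation dl |y|^2 stays below the assumed excess of P over 2 um at x. As P <= 2 um on the
   maximum set and on the adherent boundary, the perturbed maximum p must lie in N. *)
pose dl := (\sum_i D i x ^+ 2 + 2 * u x - 2 * um) / (B + 1).
have B1 : 0 < B + 1 by rewrite ltr_wpDl.
have dl0 : 0 < dl by rewrite divr_gt0 // subr_gt0.
have dlB : dl * B < \sum_i D i x ^+ 2 + 2 * u x - 2 * um.
  rewrite -[ltRHS](@divfK _ (B + 1)) ?gt_eqF // -/dl ltr_pM2l //; lra.
have PE y : Om y -> P y = \sum_i D i y ^+ 2 + 2 * u y.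
  by move=> Oy; congr (_ + _); apply: eq_bigr => i _; rewrite gD.
have [p cp pmax] : exists2 p, closure N p & forall y, closure N y ->
    P y + dl * sqn (y - 0) <= P p + dl * sqn (p - 0).
  apply: (@evt_max R n (closure N) (fun y => P y + dl * sqn (y - 0)) M).
  - by exists x; exact: subset_closure.
  - exact: closed_closure.
  - by move=> y /closure_comp_sub; exact: HM.
  - move=> y; apply: continuous_atD; [apply: continuous_atD|].
    + apply: continuous_sum => i; apply: continuous_sqr.
      by apply: within_closure_comp; exact: (cg i).1.
    + apply: continuous_atM; first exact: continuous_at_cst.
      exact: within_closure_comp.
    + apply: continuous_atM; first exact: continuous_at_cst.
      by apply: continuous_subspaceT; exact: sqn_continuous.
have Np : N p.
  have := pmax x (subset_closure Nx); rewrite PE ?subr0; last by case: (comp_sub Nx).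
  have := HB p cp; have := sqn_ge0 x; move=> sx sp.
  have h1 : dl * sqn p <= dl * B by rewrite ler_pM2l.
  have h2 : 0 <= dl * sqn x by rewrite mulr_ge0 // ltW.
  have [//|Mp|bp] := closure_comp cp => Pp; exfalso.
    have Op : Om p by case: Mp.
    have Pp' : P p = 2 * um.
      rewrite PE // big1 => [|i _]; last by rewrite MAX_grad // expr0n.
      by case: Mp => _ ->; rewrite add0r.
    by lra.
  have Pp' : P p = \sum_i g i p ^+ 2 by rewrite /P u0 // mulr0 addr0.
  by have := bdg bp cp; lra.
have [Op _] := comp_sub Np.
(* The quadratic term cancels the Laplacian -n of u, so w is harmonic. *)
pose w y := u y + 2^-1 * sqn (y - p).
pose Dw i y := D i y + (y 0 i - p 0 i).
pose DDw i j y := DD i j y + (i == j)%:R.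
(* The data are halved: b is the gradient of u at p, while c = dl p and dl / 2 come from expanding
   dl |y|^2 / 2 about p. *)
apply: (@dilation_no_max R n Om w Dw DDw oOm _ _ _ _ _ _ p (\row_i D i p) (dl *: p) (dl / 2)) => //.
- move=> y Oy i; have ds := sqn_derive p y i; have du := sol_derive i Oy.
  apply: (is_derive_eq (is_deriveD du (is_deriveZ 2^-1 ds))).
  by rewrite /Dw; congr (_ + _); rewrite /GRing.scale /= mulKf.
- move=> y Oy; apply: continuous_atD; first exact: sol_continuous.
  by apply: continuous_atM; [exact: continuous_at_cst|exact: sqn_continuous].
- move=> y Oy i; apply: continuous_atD; first exact: sol_D_continuous.
  by apply: continuous_atD; [exact: coord_continuous|exact: continuous_at_cst].
- move=> y Oy i j; exact: (is_deriveD (sol_derive2 i j Oy) (coord_derive_dir (p 0 i) y i j)).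
- move=> y Oy i j; apply: continuous_atD; first exact: sol_DD_continuous.
  exact: continuous_at_cst.
- move=> y Oy; rewrite /DDw big_split /= sol_laplacian //.
  under eq_bigr do rewrite eqxx.
  by rewrite sumr_const card_ord addrC subrr.
- by rewrite divr_gt0.
have [d d0 dN] := (iffLR (openP _)) comp_open p Np.
exists d => // y /dN Ny; have [Oy _] := comp_sub Ny.
have := pmax y (subset_closure Ny); rewrite !PE // !subr0.
have -> : sqn y = sqn p + 2 * (\sum_i (y 0 i - p 0 i) * p 0 i) + sqn (y - p).
  have {1}-> : y = (y - p) + p by rewrite subrK.
  rewrite (sqnD (y - p)); have -> : dotp (y - p) p = \sum_i (y 0 i - p 0 i) * p 0 i.
    by apply: eq_bigr => i _; rewrite !mxE.
  by ring.
have sq0 : 0 <= \sum_i (D i y - (D i p - (y 0 i - p 0 i))) ^+ 2.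
  by apply: sumr_ge0 => i _; exact: sqr_ge0.
(* With a = grad u (p) - (y - p), this is |grad u|^2 = |grad u - a|^2 + 2 a . grad u - |a|^2,
   rewritten through grad w = grad u + (y - p); dropping the first square gives the minorant. *)
have E1 : \sum_i D i y ^+ 2 = \sum_i (D i y - (D i p - (y 0 i - p 0 i))) ^+ 2 +
    2 * (\sum_i (\row_i D i p - (y - p)) 0 i * Dw i y) + sqn (y - p) - \sum_i D i p ^+ 2.
  rewrite /sqn mulr_sumr -!big_split -sumrB /=; apply: eq_bigr => i _.
  by rewrite /Dw !mxE; ring.
have E2 : \sum_i (\row_i D i p) 0 i * Dw i p = \sum_i D i p ^+ 2.
  by apply: eq_bigr => i _; rewrite /Dw subrr addr0 mxE expr2.
have E3 : \sum_i (y 0 i - p 0 i) * (dl *: p) 0 i = dl * \sum_i (y 0 i - p 0 i) * p 0 i.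
  by rewrite mulr_sumr; apply: eq_bigr => i _; rewrite mxE; ring.
have E4 : w p = u p by rewrite /w subrr sqn0 mulr0 addr0.
have E5 : w y = u y + 2^-1 * sqn (y - p) by [].
rewrite E1 E2 E3 E4 E5.
move: (\sum_i _ * Dw i y) (\sum_i (y 0 i - p 0 i) * p 0 i) (\sum_i D i p ^+ 2)
  (sqn (y - p)) (sqn p) sq0; move: (\sum_i (_ - _) ^+ 2) (u y) (u p).
by move=> {}S a1 a2 a3 a4 a5 a6 a7 sq0 H; lra.
Qed.

Lemma gradient_bound_closure x : closure N x -> Om x ->
  \sum_i D i x ^+ 2 + 2 * u x <= 2 * um.
Proof.
move=> cx Ox; have [/gradient_bound//|Mx|[_ /(_ Ox)]//] := closure_comp cx.
rewrite big1 => [|i _]; last by rewrite MAX_grad // expr0n.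
by case: Mx => _ ->; rewrite add0r.
Qed.

Lemma MAX_closed : closed (MAX Om u).
Proof.
case: (sol) => _ cu u0 _ _ x cx.
have cOx : closure Om x by move: x cx; apply: closureS => y [].
have ux : u x = um.
  apply/eqP/negPn/negP => ne.
  have e0 : 0 < `|um - u x| by rewrite normr_gt0 subr_eq0 eq_sym.
  have [d d0 dP] := (iffLR (continuous_withinP _ _)) cu x cOx _ e0.
  have [y [Oy uy] yx] := (iffLR (closureP _ _)) cx d d0.
  by have := dP y (subset_closure Oy) yx; rewrite uy ltxx.
split => //; have [//|bx] := closure_split cOx.
by have := umax_gt0; rewrite -ux u0 // ltxx.
Qed.

Lemma cube_closure (a x : V) (r : R) : 0 < r ->
  (forall y, `|y - a| < r -> N y) -> `|x - a| <= r -> closure N x.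
Proof.
move=> r0 aN xr; apply/closureP => e e0.
have er : 0 < e + r by rewrite addr_gt0.
pose t := e / (e + r); have t0 : 0 < t by rewrite divr_gt0.
have t1 : t < 1 by rewrite ltr_pdivrMr // mul1r ltrDl.
exists (a + (1 - t) *: (x - a)).
  apply: aN; rewrite addrC addKr normrZ gtr0_norm ?subr_gt0 //.
  have := normr_ge0 (x - a); nra.
have -> : a + (1 - t) *: (x - a) - x = - (t *: (x - a)).
  by apply/rowP => i; rewrite !mxE; ring.
rewrite normrN normrZ gtr0_norm // (le_lt_trans (_ : _ <= t * r)) ?ler_pM2l //.
by rewrite /t mulrAC ltr_pdivrMr // ltr_pM2l // ltrDr.
Qed.

(** Take a in N close to a maximum point and p a nearest point of the maximum set in the sup norm.
    The open cube about a reaching p stays in Om and misses the maximum set, hence lies in N. *)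
Lemma touching_cube : exists (a p : V) (r : R),
  [/\ 0 < r, (forall y, `|y - a| < r -> N y), MAX Om u p & `|p - a| = r].
Proof.
have [q Mq cq] := MAX_comp_nonempty; have Oq : Om q by case: Mq.
have [M HM] := closure_bounded.
have [d d0 dO] := (iffLR (openP _)) oOm q Oq.
have d20 : 0 < d / 2 by rewrite divr_gt0.
have [a Na aq] := (iffLR (closureP _ _)) cq (d / 2) d20.
have [p Mp pmin] : exists2 p, MAX Om u p & forall y, MAX Om u y -> - `|y - a| <= - `|p - a|.
  apply: (@evt_max R n _ (fun y => - `|y - a|) M).
  - by exists q.
  - exact: MAX_closed.
  - by move=> y [Oy _]; apply: HM; exact: subset_closure.
  - apply/continuous_withinP => x _ e e0; exists e => // y _; apply: le_lt_trans.
    rewrite opprK addrC; apply: le_trans (ler_dist_dist _ _) _.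
    by rewrite opprB addrA subrK distrC.
have pa : p != a.
  by apply/eqP => E; move: Na; rewrite -E => /(component_sub CN)[_]; apply.
exists a, p, `|p - a|; split => //; first by rewrite normr_gt0 subr_eq0.
apply: (cube_sub_component CN); last by exists a => //; rewrite subrr normr0 normr_gt0 subr_eq0.
move=> x xa; split; last first.
  by move=> /pmin; rewrite lerN2 leNgt xa.
apply: dO; rewrite -(subrK a x) -addrA (le_lt_trans (ler_normD _ _)) //.
rewrite [ltRHS]splitr ltrD // (lt_trans _ aq) // (lt_le_trans xa) //.
by rewrite [leRHS]distrC -lerN2 pmin.
Qed.

(** As D j vanishes at p, its expansion is the definition of the derivative. That of u follows by
    the mean value theorem applied to u minus its quadratic term. *)
Lemma second_order_expansion p i : MAX Om u p -> forall e : R, 0 < e ->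
  exists2 r : R, 0 < r & forall h : R, `|h| < r ->
    `|u (p + h *: ebase R i) - um - DD i i p / 2 * h ^+ 2| <= e * h ^+ 2 /\
    forall j, `|D j (p + h *: ebase R i) - h * DD j i p| <= e * `|h|.
Proof.
move=> Mp e e0; have Op : Om p by case: Mp.
have [d d0 dO] := (iffLR (openP _)) oOm p Op.
have /choice[rr rrP] : forall j, exists r : R, 0 < r /\ forall h : R, `|h| < r ->
    `|D j (p + h *: ebase R i) - h * DD j i p| <= e * `|h|.
  move=> j; have [r r0 H] := (iffLR (is_deriveP _ _ _ _)) (sol_derive2 j i Op) e e0.
  by exists r; split => // h /H; rewrite (MAX_grad j Mp) subr0.
have en : 0 < `|ebase R i| + 1 by rewrite ltr_wpDl.
pose r := \big[Num.min/(d / (`|ebase R i| + 1))]_j rr j.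
have r0 : 0 < r.
  by apply/bigmin_gtP; split => [|j _]; [rewrite divr_gt0|case: (rrP j)].
exists r => // h hr; have Dh k j : `|k| <= `|h| ->
    `|D j (p + k *: ebase R i) - k * DD j i p| <= e * `|k|.
  move=> kh; apply: (rrP j).2; apply: le_lt_trans kh _; apply: lt_le_trans hr _.
  exact: bigmin_le_cond.
split => [|j]; last exact: Dh.
have hd : `|h| * (`|ebase R i| + 1) < d.
  by rewrite -ltr_pdivlMr //; apply: lt_le_trans hr _; exact: bigmin_le_id.
have inO (t : R) : 0 <= t <= 1 -> Om (p + t *: (h *: ebase R i)).
  move=> /andP[t0 t1]; apply: dO; rewrite addrC addKr !normrZ ger0_norm //.
  apply: le_lt_trans hd; rewrite (le_trans (_ : _ <= `|h| * `|ebase R i|)) //.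
    by rewrite ler_piMl // mulr_ge0.
  by rewrite ler_wpM2l // lerDl.
pose f (y : V) := u y + (- (DD i i p / 2)) * (y 0 i - p 0 i) ^+ 2.
have [t t01|t t01] := @line_mean_value R _ f p (h *: ebase R i)
    (fun t => h * (D i (p + t *: (h *: ebase R i)) - (t * h) * DD i i p)).
  apply: is_derive_scaledir.
  have dc := coord_derive (p 0 i) (p + t *: (h *: ebase R i)) i.
  have du := sol_derive i (inO t t01).
  apply: (is_derive_eq (is_deriveD du (is_deriveZ (- (DD i i p / 2)) (is_deriveM dc dc)))).
  by rewrite !mxE !eqxx /GRing.scale /=; field.
have -> : f (p + h *: ebase R i) - f p =
    u (p + h *: ebase R i) - um - DD i i p / 2 * h ^+ 2.
  case: Mp => _ E; rewrite /f !mxE !eqxx /= E. by field.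
move=> ->; case/andP: t01 => t0 t1.
have th : `|t * h| <= `|h| by rewrite normrM ger0_norm // ler_piMl.
rewrite normrM scalerA -(real_normK (num_real h)) expr2 mulrCA ler_wpM2l //.
by apply: le_trans (Dh _ _ th) _; rewrite ler_wpM2l // ltW.
Qed.

(** At p + h e_i the bound |grad u|^2 <= 2 (um - u) reads, to second order, h^2 times the claimed
    inequality; e controls the remainders and tends to 0. *)
Lemma hessian_row_bound p : MAX Om u p ->
  (exists (a : V) (r : R), [/\ 0 < r, forall y, `|y - a| < r -> N y & `|p - a| = r]) ->
  forall i, \sum_j DD j i p ^+ 2 <= - DD i i p.
Proof.
move=> Mp [a [r [r0 aN par]]] i; have Op : Om p by case: Mp.
have [d d0 dO] := (iffLR (openP _)) oOm p Op.
have en : 0 < `|ebase R i| + 1 by rewrite ltr_wpDl.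
pose B := \sum_j `|DD j i p|.
have B0 : 0 <= B by exact: sumr_ge0.
suff key (e : R) : 0 < e -> \sum_j DD j i p ^+ 2 + DD i i p <= 2 * e * (1 + B).
  rewrite -subr_le0 opprK; apply/ler_addgt0Pr => e e0.
  have B2 : 0 < 2 * (1 + B) by rewrite mulr_gt0 // ltr_pwDl.
  apply: le_trans (key (e / (2 * (1 + B))) _) _; first by rewrite divr_gt0.
  by rewrite add0r mulrAC mulrC divfK // gt_eqF.
move=> e0; have [rho rho0 H] := second_order_expansion i Mp e0.
pose m := Num.min (Num.min rho r) (d / (`|ebase R i| + 1)).
have m0 : 0 < m by rewrite !lt_min rho0 r0 divr_gt0.
pose t := m / 2; have t0 : 0 < t by rewrite divr_gt0.
have : t < m by rewrite /t ltr_pdivrMr // ltr_pMr // ltr1n.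
rewrite !lt_min => /andP[/andP[trho tr]]; rewrite ltr_pdivlMr // => td.
(* The sign moves coordinate i of p towards a. Since the other coordinates are unchanged, the point
   stays in the closed cube. *)
pose h := if p 0 i <= a 0 i then t else - t.
have hn : `|h| = t by rewrite /h; case: ifP => _; rewrite ?normrN gtr0_norm.
have h2 : h ^+ 2 = t ^+ 2 by rewrite /h; case: ifP => _; rewrite ?sqrrN.
have xO : Om (p + h *: ebase R i).
  apply: dO; rewrite addrC addKr normrZ hn (le_lt_trans _ td) //.
  by rewrite ler_pM2l // lerDl.
have xN : closure N (p + h *: ebase R i).
  apply: (cube_closure r0 aN); apply/norm_leP => [|j]; first exact: ltW.
  have := coord_le_norm (p - a) j; rewrite par !mxE.
  have [->|ji] := eqVneq j i; last by rewrite mulr0 addr0.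
  rewrite mulr1 /h !ler_norml => /andP[h1 h3]; case: ifPn => ap.
    by apply/andP; split; lra.
  by rewrite -ltNge in ap; apply/andP; split; lra.
clearbody h t.
have := H h; rewrite hn => /(_ trho)[]; rewrite h2 => Hu HD.
have := gradient_bound_closure xN xO.
have : t ^+ 2 * (\sum_j DD j i p ^+ 2 - 2 * e * B) <= \sum_j D j (p + h *: ebase R i) ^+ 2.
  rewrite /B mulr_sumr -sumrB mulr_sumr; apply: ler_sum => j _.
  have := HD j; set b := DD j i p; set v := D j _.
  pose er := v - h * b; rewrite -/er => er1.
  have -> : v = h * b + er by rewrite /er addrC subrK.
  rewrite sqrrD exprMn h2.
  have : - (t * `|b| * (e * t)) <= h * b * er.
    rewrite lerNl; apply: le_trans (ler_norm _) _.
    by rewrite normrN !normrM hn ler_wpM2l // mulr_ge0 // ltW.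
  have := sqr_ge0 er; nra.
move: Hu; rewrite ler_norml => /andP[Hu _] HS Hg.
have t20 : 0 < t ^+ 2 by rewrite exprn_gt0.
rewrite -(ler_pM2l t20).
move: (\sum_j D j (p + h *: ebase R i) ^+ 2) HS Hg => T HS Hg.
move: (B : R) (\sum_j DD j i p ^+ 2) (DD i i p) (u (p + h *: ebase R i)) (um)
  (t ^+ 2 : R) (e : R) HS Hg Hu => b S A v M t2 ep HS Hg Hu; lra.
Qed.

(** The row bound gives DD i i >= -1 and the trace is -n, so every diagonal entry is -1; this
    exhausts the row bound and the other entries vanish. *)
Lemma hessian_identity p : MAX Om u p ->
  (exists (a : V) (r : R), [/\ 0 < r, forall y, `|y - a| < r -> N y & `|p - a| = r]) ->
  forall i j, DD i j p = - (i == j)%:R.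
Proof.
move=> Mp Hc; have H := hessian_row_bound Mp Hc; have Op : Om p by case: Mp.
have Hi i : DD i i p ^+ 2 <= - DD i i p.
  apply: le_trans (H i); rewrite (bigD1 i) //= lerDl sumr_ge0 // => j _; exact: sqr_ge0.
have ge i : 0 <= DD i i p + 1 by have := Hi i; nra.
have S0 : \sum_i (DD i i p + 1) = 0.
  by rewrite big_split /= sol_laplacian // sumr_const card_ord addrC subrr.
have E i : DD i i p = -1.
  have /eqP := @psumr_eq0P _ _ _ _ (fun i _ => ge i) S0 i isT.
  by rewrite addr_eq0 => /eqP.
move=> i j; have [->|ij] := eqVneq i j; first exact: E.
have := H j; rewrite (bigD1 j) //= (bigD1 i) //= E sqrrN expr1n opprK => K.
have : 0 <= \sum_(k < n | (k != j) && (k != i)) DD k j p ^+ 2.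
  by apply: sumr_ge0 => k _; exact: sqr_ge0.
move=> K2; apply/eqP; rewrite oppr0 -sqrf_eq0 eq_le sqr_ge0 andbT; lra.
Qed.

(** z = u + |y - p|^2 / 2 has zero Hessian at p, so nearby it differs from um by at most a quarter
    of the squared sup norm of y - p. Hence u < um off p, and the punctured cube lies in one
    component. *)
Lemma punctured_neighborhood p : MAX Om u p -> closure N p ->
  (forall i j, DD i j p = - (i == j)%:R) ->
  exists2 r : R, 0 < r & forall x, `|x - p| < r -> x != p -> N x.
Proof.
move=> Mp cp Hp; have Op : Om p by case: Mp.
have [d d0 dO] := (iffLR (openP _)) oOm p Op.
pose z y := u y + 2^-1 * sqn (y - p).
pose Dz i y := D i y + (y 0 i - p 0 i).
pose DDz i j y := DD i j y + (i == j)%:R.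
have dz y i : Om y -> is_derive y (ebase R i) z (Dz i y).
  move=> Oy; apply: (is_derive_eq (is_deriveD (sol_derive i Oy)
    (is_deriveZ 2^-1 (sqn_derive p y i)))).
  by rewrite /Dz; congr (_ + _); rewrite /GRing.scale /= mulKf.
have dDz y i j : Om y -> is_derive y (ebase R j) (Dz i) (DDz i j y).
  move=> Oy; exact: (is_deriveD (sol_derive2 i j Oy) (coord_derive_dir (p 0 i) y i j)).
(* Two uses of [coordinate_lipschitz] cost n^2 and the cube of radius 2 |x - p| a factor 2, so that
   2 n^2 e = 1/4. *)
pose e : R := (8 * n%:R ^+ 2)^-1.
have e0 : 0 < e by rewrite invr_gt0 mulr_gt0 // exprn_gt0.
have /choice[rr rrP] : forall k : 'I_n * 'I_n, exists r : R, 0 < r /\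
    forall y, `|y - p| < r -> `|DDz k.1 k.2 y| <= e.
  move=> [i j]; have [r r0 H] := (iffLR (continuous_atP _ _)) (@sol_DD_continuous p i j Op) e e0.
  by exists r; split => // y /H /ltW; rewrite Hp opprK.
pose r := \big[Num.min/d]_k rr k.
have r0 : 0 < r by apply/bigmin_gtP; split => // k _; case: (rrP k).
have rO y : `|y - p| < r -> Om y.
  by move=> yr; apply: dO; apply: lt_le_trans yr _; exact: bigmin_le_id.
have rDD y i j : `|y - p| < r -> `|DDz i j y| <= e.
  move=> yr; apply: (rrP (i, j)).2; apply: lt_le_trans yr _; exact: bigmin_le_cond.
have Dzp i : Dz i p = 0 by rewrite /Dz MAX_grad // subrr addr0.
have rD y i : `|y - p| < r -> `|Dz i y| <= n%:R * (e * `|y - p|).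
  move=> yr; rewrite -[Dz i y]subr0 -(Dzp i).
  apply: (@coordinate_lipschitz R n (Dz i) (DDz i) p r e) => //; last by rewrite subrr normr0.
  by move=> x xr j; split; [apply: dDz; exact: rO|exact: rDD].
have zb x : `|x - p| < r -> `|z x - um| <= `|x - p| ^+ 2 / 4.
  move=> xr; have [->|xp] := eqVneq x p.
    by case: Mp => _ E; rewrite /z subrr sqn0 mulr0 addr0 E subrr !normr0 expr0n mul0r.
  have m0 : 0 < `|x - p| by rewrite normr_gt0 subr_eq0.
  pose r' := Num.min (2 * `|x - p|) r.
  have xr' : `|x - p| < r' by rewrite lt_min xr andbT ltr_pMl // ltr1n.
  have zp : z p = um by case: Mp => _ E; rewrite /z subrr sqn0 mulr0 addr0 E.
  have := @coordinate_lipschitz R n z Dz p r' (n%:R * (e * (2 * `|x - p|))) _ p x _ xr'.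
  rewrite zp subrr normr0 => H; apply: le_trans (H _ _) _.
  - move=> y; rewrite lt_min => /andP[y1 y2] i; split; first by apply: dz; exact: rO.
    by apply: le_trans (rD y i y2) _; rewrite ler_wpM2l // ler_pM2l // ltW.
  - by apply: lt_trans xr'.
  have nn : n%:R != 0 :> R by rewrite gt_eqF.
  by rewrite /e le_eqVlt; apply/orP; left; apply/eqP; field.
exists r => //.
apply: (@punctured_cube_sub_component R n W N p r) => //.
- exact: ltnW.
- exact: offmax_open.
- move=> x xr xp; apply/offmaxE; split; first exact: rO.
  have m0 : 0 < `|x - p| by rewrite normr_gt0 subr_eq0.
  have := zb x xr; rewrite ler_norml /z => /andP[_].
  have := sqr_norm_le (x - p); have : 0 < `|x - p| ^+ 2 by rewrite exprn_gt0.
  move: (`|x - p| ^+ 2) (sqn (x - p)) (u x) => a b c; lra.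
- by have [y Ny yp] := (iffLR (closureP _ _)) cp r r0; exists y.
- by move=> [_]; apply.
Qed.

(** The gradient bound says that sqrt(2 (um - u)) grows at most at unit speed, and it vanishes at p.
    The term k^2 keeps the square root differentiable at p and is removed by letting k tend to 0. *)
Lemma height_le_on_ray p x : MAX Om u p ->
  (forall t : R, 0 < t <= 1 -> N (p + t *: (x - p))) ->
  2 * (um - u x) <= sqn (x - p).
Proof.
move=> Mp ray; have Op : Om p by case: Mp.
have rayO (t : R) : 0 <= t <= 1 -> Om (p + t *: (x - p)).
  move=> /andP[t0 t1]; have [->|tn] := eqVneq t 0; first by rewrite scale0r addr0.
  by apply: (comp_sub (ray t _)).1; rewrite t1 andbT lt_neqAle eq_sym tn.
have rayB (t : R) : 0 <= t <= 1 -> \sum_i D i (p + t *: (x - p)) ^+ 2 <=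
    2 * (um - u (p + t *: (x - p))).
  move=> /andP[t0 t1]; have [->|tn] := eqVneq t 0.
    rewrite scale0r addr0 big1 => [|i _]; last by rewrite MAX_grad // expr0n.
    by case: Mp => _ ->; rewrite subrr mulr0.
  have := @gradient_bound (p + t *: (x - p)) (ray t _).
  by rewrite t1 andbT lt_neqAle eq_sym tn t0 => /(_ isT); lra.
pose L := enorm (x - p).
suff key (k : R) : 0 < k -> Num.sqrt (2 * (um - u x) + k ^+ 2) <= L + k.
  have F0 : 0 <= 2 * (um - u x).
    have := rayB 1; rewrite scale1r addrC subrK lexx ler01 => /(_ isT).
    by apply: le_trans; apply: sumr_ge0 => i _; exact: sqr_ge0.
  have : Num.sqrt (2 * (um - u x)) <= L.
    apply/ler_addgt0Pr => k k0; apply: le_trans (key k k0).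
    by rewrite ler_sqrt ?lerDl ?sqr_ge0 // addr_ge0 ?sqr_ge0.
  by rewrite /L enormE ler_sqrt ?sqn_ge0.
move=> k0; have k20 : 0 < k ^+ 2 by rewrite exprn_gt0.
pose F (t : R) := 2 * (um - u (p + t *: (x - p))) + k ^+ 2.
pose dU (t : R) := \sum_i (x - p) 0 i * D i (p + t *: (x - p)).
have Fpos (t : R) : 0 <= t <= 1 -> 0 < F t.
  move=> t01; rewrite /F ltr_wpDl //; apply: le_trans (rayB t t01).
  by apply: sumr_ge0 => i _; exact: sqr_ge0.
have dF (t : R) : 0 <= t <= 1 -> is_derive t 1 F (- 2 * dU t).
  move=> t01; have du : is_derive t 1 (fun s : R => u (p + s *: (x - p))) (dU t).
    apply: is_derive_line; apply: (@total_derive_in R n Om u (fun i => D i)) => //.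
    - by move=> y Oy i; exact: sol_derive.
    - by move=> y Oy i; exact: sol_D_continuous.
    - exact: rayO.
  have -> : F = cst (2 * um + k ^+ 2) + (- 2) *: (fun s : R => u (p + s *: (x - p))).
    by apply/funext => s; rewrite /F /= !fctE /GRing.scale /=; ring.
  have dc : is_derive t 1 (cst (2 * um + k ^+ 2) : R -> R) 0 by exact: is_derive_cst.
  by apply: (is_derive_eq (is_deriveD dc (is_deriveZ (- 2) du))); rewrite add0r.
have dG (t : R) : 0 <= t <= 1 -> is_derive t 1 (fun s => Num.sqrt (F s))
    ((2 * Num.sqrt (F t))^-1 * (- 2 * dU t)).
  by move=> t01; exact: is_derive1_comp (is_derive1_sqrt (Fpos t t01)) (dF t t01).
have cont : {within `[0, 1], continuous (fun s => Num.sqrt (F s))}.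
  apply: derivable_within_continuous => t; rewrite in_itv /= => t01.
  exact: (ex_derive (is_derive := dG t t01)).
have dGo (t : R) : t \in `]0, 1[ -> is_derive t 1 (fun s => Num.sqrt (F s))
    ((2 * Num.sqrt (F t))^-1 * (- 2 * dU t)).
  by move=> /subset_itv_oo_cc; rewrite in_itv /=; exact: dG.
have [t + E] := MVT_segment ler01 dGo cont.
rewrite in_itv /= => t01.
have F1 : F 1 = 2 * (um - u x) + k ^+ 2 by rewrite /F scale1r addrC [p + _]addrC subrK addrC.
have F0 : Num.sqrt (F 0) = k.
  by case: Mp => _ Eu; rewrite /F scale0r addr0 Eu subrr mulr0 add0r sqrtr_sqr gtr0_norm.
rewrite -F1 -lerBlDr -{1}F0 E subr0 mulr1.
have q0 : 0 < Num.sqrt (F t) by rewrite sqrtr_gt0 Fpos.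
have -> : (2 * Num.sqrt (F t))^-1 * (- 2 * dU t) = (- dU t) / Num.sqrt (F t).
  by field; rewrite gt_eqF.
rewrite ler_pdivrMr //; apply: le_trans (ler_norm _) _; rewrite normrN.
rewrite -(@ler_pXn2r _ 2) ?nnegrE ?mulr_ge0 ?enorm_ge0 ?(ltW q0) //.
rewrite exprMn /L sqr_enorm real_normK ?num_real // sqr_sqrtr ?(ltW (Fpos t t01)) //.
apply: le_trans (cauchy_schwarz_sum _ _) _; rewrite ler_wpM2l ?sqn_ge0 //.
by apply: le_trans (rayB t t01) _; rewrite /F lerDl ltW.
Qed.

(** z = um - u - |x - p|^2 / 2 is harmonic, nonpositive by the ray estimate, and zero at p, so the
    strong maximum principle applies. *)
Lemma height_on_ball p (s : R) : MAX Om u p -> 0 < s ->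
  (forall x, sqn (x - p) < s ^+ 2 -> x != p -> N x) ->
  forall x, sqn (x - p) < s ^+ 2 -> um - u x = sqn (x - p) / 2.
Proof.
move=> Mp s0 sN; have Op : Om p by case: Mp.
have sO x : sqn (x - p) < s ^+ 2 -> Om x.
  by have [->//|xp xs] := eqVneq x p; exact: (comp_sub (sN x xs xp)).1.
pose z x := (um + (- 1) * u x) + (- 2^-1) * sqn (x - p).
suff z0 x : sqn (x - p) < s ^+ 2 -> z x = 0.
  move=> x /z0; rewrite /z => H; move: (um) (u x) (sqn _) H => a b c; lra.
apply: (@harmonic_strong_max R n p s z
  (fun i x => (0 + (- 1) * D i x) + (- 2^-1) * (2 * (x 0 i - p 0 i)))
  (fun i x => (0 + (- 1) * DD i i x) + (- 2^-1) * 2)) => //.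
- move=> y /sO Oy; apply: continuous_atD; [apply: continuous_atD|].
  + exact: continuous_at_cst.
  + by apply: continuous_atM; [exact: continuous_at_cst|exact: sol_continuous].
  + by apply: continuous_atM; [exact: continuous_at_cst|exact: sqn_continuous].
- apply: partials2D; [apply: partials2D; first exact: partials2C|].
    by apply: partials2Z => y /sO Oy; exact: sol_partials2.
  by apply: partials2Z; exact: partials2_sqn.
- move=> y /sO Oy; rewrite !big_split /= big1 // -mulr_sumr sol_laplacian //.
  have -> : \sum_(i < n) - 2^-1 * 2 = - n%:R :> R.
    by rewrite sumr_const card_ord mulNr mulVf // mulNrn.
  by rewrite add0r mulN1r opprK subrr.
- move=> y ys; have [->|yp] := eqVneq y p.
    by case: Mp => _ E; rewrite /z subrr sqn0 mulr0 addr0 E mulN1r subrr.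
  have := @height_le_on_ray p y Mp.
  rewrite /z; move=> H; have {}H : 2 * (um - u y) <= sqn (y - p).
    apply: H => t /andP[t0 t1]; apply: sN.
      rewrite addrC addKr sqnZ (le_lt_trans _ ys) // ler_piMl ?sqn_ge0 //.
      by rewrite exprn_ile1 // ltW.
    rewrite -subr_eq0 addrC addKr scaler_eq0 subr_eq0 negb_or yp andbT.
    by rewrite gt_eqF.
  move: (um) (u y) (sqn _) H => a b c; lra.
- by case: Mp => _ E; rewrite /z subrr sqn0 mulr0 addr0 E mulN1r subrr.
Qed.

(** The largest punctured ball about p inside N touches the complement of N at some q. There um - u
    = s^2 / 2 > 0, so q lies on the boundary of Om and um = s^2 / 2. Then u vanishes on the closure
    of Om along the whole sphere, which therefore cannot meet Om. *)
Lemma serrin_ball : exists (p : V) (s : R), [/\ 0 < s,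
  Om = [set x | sqn (x - p) < s ^+ 2] &
  forall x, Om x -> u x = (s ^+ 2 - sqn (x - p)) / 2].
Proof.
have [a [p [r0 [r00 aN Mp par]]]] := touching_cube.
have Op : Om p by case: Mp.
have cp : closure N p by apply: (cube_closure r00 aN); rewrite par.
have Hp : forall i j, DD i j p = - (i == j)%:R.
  by apply: hessian_identity => //; exists a, r0.
have [r r_gt0 rN] := punctured_neighborhood Mp cp Hp.
case: (sol) => _ cu u0 _ _.
have oNp : open (N `|` [set p]).
  apply/openP => x [Nx|->].
    have [d d0 dN] := (iffLR (openP _)) comp_open x Nx.
    by exists d => // y /dN; left.
  by exists r => // y yr; have [->|yp] := eqVneq y p; [right|left; exact: rN].
have [c0 [bc0 cc0]] := bd_comp_nonempty.
have nNp x : bd Om x -> (~` (N `|` [set p])) x.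
  by move=> bx [/comp_sub[/(bd_disjoint bx)]|E]//; apply: (bd_disjoint bx); rewrite E.
(* Restricting to points no farther from p than the boundary point c0 makes the set compact without
   changing the minimum. *)
have [q [nq _] qmin] : exists2 q,
    (~` (N `|` [set p]) `&` [set x | sqn (x - p) <= sqn (c0 - p)]) q &
    forall x, (~` (N `|` [set p]) `&` [set x | sqn (x - p) <= sqn (c0 - p)]) x ->
      - sqn (x - p) <= - sqn (q - p).
  apply: (@evt_max R n _ (fun x => - sqn (x - p))).
  - by exists c0; split => /=; first exact: nNp.
  - by apply: closedI; [exact: open_closedC|exact: closed_sqn_le].
  - by move=> x [_]; exact: sqn_le_bounded.
  - apply: continuous_subspaceT => x.
    rewrite -[continuous_at _ _]/{for x, continuous _}.
    by apply: continuous_atN; exact: sqn_continuous.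
have {}qmin x : (~` (N `|` [set p])) x -> sqn (q - p) <= sqn (x - p).
  move=> nx; have [xc|cx] := leP (sqn (x - p)) (sqn (c0 - p)).
    by rewrite -lerN2; apply: qmin.
  by apply: le_trans (ltW cx); rewrite -lerN2; apply: qmin; split => //=; exact: nNp.
have qp : q != p by apply/eqP => E; apply: nq; right.
pose s := enorm (q - p); have s2 : s ^+ 2 = sqn (q - p) by exact: sqr_enorm.
have s0 : 0 < s.
  rewrite lt_neqAle enorm_ge0 andbT eq_sym; apply/eqP => /enorm_eq0 /eqP.
  by rewrite subr_eq0 (negPf qp).
have s20 : 0 < s ^+ 2 by rewrite exprn_gt0.
have sN x : sqn (x - p) < s ^+ 2 -> x != p -> N x.
  rewrite s2 => xs xp; apply: contrapT => nx.
  have := qmin x; rewrite leNgt xs => H; apply/not_implyP: H; split => // -[//|/eqP].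
  by rewrite (negPf xp).
have hb := height_on_ball Mp s0 sN.
have sO x : sqn (x - p) < s ^+ 2 -> Om x.
  by have [->//|xp xs] := eqVneq x p; exact: (comp_sub (sN x xs xp)).1.
have approx x (t : R) : sqn (x - p) = s ^+ 2 -> 0 < t < 1 ->
    sqn (p + (1 - t) *: (x - p) - p) < s ^+ 2.
  move=> xs /andP[t0 t1]; rewrite addrC addKr sqnZ xs gtr_pMl //.
  by rewrite expr_lt1 //; lra.
have near x (d : R) : 0 < d -> exists t : R, [/\ 0 < t < 1, t < d &
    `|p + (1 - t) *: (x - p) - x| < d].
  move=> d0; have n1 : 0 < `|x - p| + 1 by rewrite ltr_wpDl.
  pose t := Num.min (Num.min 1 d) (d / (`|x - p| + 1)) / 2.
  have m0 : 0 < Num.min (Num.min 1 d) (d / (`|x - p| + 1)) by rewrite !lt_min ltr01 d0 divr_gt0.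
  have t0 : 0 < t by rewrite divr_gt0.
  have : t < Num.min (Num.min 1 d) (d / (`|x - p| + 1)).
    by rewrite /t ltr_pdivrMr // ltr_pMr // ltr1n.
  rewrite !lt_min => /andP[/andP[t1 td]]; rewrite ltr_pdivlMr // => tx.
  exists t; rewrite t0; split => //.
  have -> : p + (1 - t) *: (x - p) - x = - (t *: (x - p)).
    by apply/rowP => i; rewrite !mxE; ring.
  rewrite normrN normrZ gtr0_norm // (le_lt_trans _ tx) // ler_pM2l //.
  by rewrite lerDl.
have sph_cl x : sqn (x - p) = s ^+ 2 -> closure N x.
  move=> xs; apply/closureP => d d0; have [t [t01 _ tx]] := near x d d0.
  exists (p + (1 - t) *: (x - p)) => //; apply: sN; first exact: approx.
  rewrite -subr_eq0 addrC addKr scaler_eq0 negb_or; apply/andP; split.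
    by rewrite subr_eq0 gt_eqF //; case/andP: t01.
  by apply/eqP => E; move: s20; rewrite -xs E sqn0 ltxx.
(* The formula inside the ball passes to the sphere by continuity of u along the radius. *)
have sph_u x : sqn (x - p) = s ^+ 2 -> um - u x = s ^+ 2 / 2.
  move=> xs; apply/eqP/negPn/negP => ne.
  have e0 : 0 < `|um - u x - s ^+ 2 / 2| by rewrite normr_gt0 subr_eq0.
  have cx := closure_comp_sub (sph_cl x xs).
  have e20 := divr_gt0 e0 (ltr0Sn R 1).
  have [d d0 dP] := (iffLR (continuous_withinP _ _)) cu x cx _ e20.
  pose e := `|um - u x - s ^+ 2 / 2|.
  have m0 : 0 < Num.min d (e / 2 / s ^+ 2) by rewrite lt_min d0 !divr_gt0.
  have [t [t01]] := near x _ m0.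
  rewrite !lt_min => /andP[_ te] /andP[td _].
  pose y := p + (1 - t) *: (x - p).
  have ys : sqn (y - p) < s ^+ 2 by exact: approx.
  have uy := dP y (subset_closure (sO y ys)) td.
  have yp : y - p = (1 - t) *: (x - p) by rewrite /y addrC addKr.
  have := hb y ys; rewrite yp sqnZ xs => E.
  rewrite ltr_pdivlMr // in te; case/andP: t01 => t0 t1.
  have : `|um - u x - s ^+ 2 / 2| < e; last by rewrite ltxx.
  have -> : um - u x - s ^+ 2 / 2 = (u y - u x) + ((1 - t) ^+ 2 * s ^+ 2 / 2 - s ^+ 2 / 2).
    by rewrite -E; ring.
  apply: le_lt_trans (ler_normD _ _) _; rewrite [ltRHS]splitr ltrD //.
  have -> : (1 - t) ^+ 2 * s ^+ 2 / 2 - s ^+ 2 / 2 = - (t * s ^+ 2 * ((2 - t) / 2)).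
    by field.
  have ts : 0 < t * s ^+ 2 by rewrite mulr_gt0.
  rewrite normrN normrM (gtr0_norm ts) ger0_norm; last by lra.
  by apply: le_lt_trans te; rewrite ler_piMr ?(ltW ts) //; lra.
have um_s : um = s ^+ 2 / 2.
  have := sph_u q (esym s2).
  have [Nq|[_ ->]|bq] := closure_comp (sph_cl q (esym s2)).
  - by exfalso; apply: nq; left.
  - by rewrite subrr => E; exfalso; move: E s20; move: (s ^+ 2) => S; lra.
  - by rewrite u0 // subr0.
(* The ball is relatively closed in the connected set Om: a limit point on the sphere would have u =
   0, against positivity. *)
have OmE : [set x | sqn (x - p) < s ^+ 2] = Om.
  apply: connected_clopen cOm _ sO _ _.
  - by exists p; rewrite /= subrr sqn0.
  - exact: open_sqn_lt.
  move=> x cx Ox /=.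
  have xs : sqn (x - p) <= s ^+ 2.
    have /closureS : [set x | sqn (x - p) < s ^+ 2] `<=` [set x | sqn (x - p) <= s ^+ 2].
      by move=> y /= /ltW.
    by move=> /(_ x cx) /(@closed_sqn_le R n p (s ^+ 2)).
  rewrite lt_neqAle xs andbT; apply/eqP => E.
  by have := sph_u x E; have := sol_pos Ox; rewrite um_s; lra.
exists p, s; split => // x; rewrite -{1}OmE => /hb; rewrite um_s.
by move: (sqn _) (u x) (s ^+ 2) => A B C; lra.
Qed.

End Gradient.

(** * Shear stress, the ball, and equivalence with the Serrin solution *)

(** Provides the upper bounds without which the suprema in [tauS] and [tauN] would say nothing about
    individual points. *)
Lemma gradnorm_bounded : exists K : R, forall x, closure Om x -> gradnorm g x <= K.
Proof.
have [M HM] := closure_bounded; case: (sol) => _ _ _ _ cg; have [x Ox] := Om0.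
have [c cc cmax] : exists2 c, closure Om c & forall y, closure Om y ->
    \sum_i g i y ^+ 2 <= \sum_i g i c ^+ 2.
  apply: (@evt_max R n (closure Om) (fun y => \sum_i g i y ^+ 2) M) => //.
  - by exists x; exact: subset_closure.
  - exact: closed_closure.
  - by apply: continuous_sum => i; apply: continuous_sqr; exact: (cg i).1.
exists (gradnorm g c) => y /cmax; rewrite /gradnorm => H.
by rewrite ler_sqrt //; apply: sumr_ge0 => i _; exact: sqr_ge0.
Qed.

Lemma le_tauN x : bd Om x -> closure N x ->
  gradnorm g x <= tauN Om u g N * Num.sqrt (2 * um).
Proof.
move=> bx cx; have [K HK] := gradnorm_bounded.
have q0 : 0 < Num.sqrt (2 * um) by rewrite sqrtr_gt0 mulr_gt0 // umax_gt0.
pose A := bd Om `&` closure N.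
have sub S y : components A S -> S y -> closure Om y.
  by move=> [z _ ->] /connected_component_sub[[]].
have HS S : components A S -> has_ubound [set gradnorm g y | y in S].
  by move=> CS; exists K => _ [y Sy <-]; apply: HK; exact: sub Sy.
pose S := connected_component A x.
have Ax : A x by split.
have CS : components A S by exists x.
rewrite -ler_pdivrMr //; apply: le_trans (_ : tauS Om u g S <= _).
  rewrite /tauS ler_pM2r ?invr_gt0 //; apply: ub_le_sup; first exact: HS.
  by exists x => //; exact: connected_component_refl.
apply: ub_le_sup; last by exists S.
exists (K / Num.sqrt (2 * um)) => _ [T CT <-].
rewrite /tauS ler_pM2r ?invr_gt0 //; apply: ge_sup.
  case: (CT) => z Az TE; exists (gradnorm g z), z => //.
  by rewrite TE; exact: connected_component_refl.
by move=> _ [y Ty <-]; apply: HK; exact: sub Ty.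
Qed.

(** By continuity g equals -(x - p) up to the boundary, where its norm is s; and sqrt(2 um) = s. *)
Lemma tauN_ball p (s : R) : 0 < s -> Om = [set x | sqn (x - p) < s ^+ 2] ->
  (forall x, Om x -> u x = (s ^+ 2 - sqn (x - p)) / 2) -> tauN Om u g N = 1.
Proof.
move=> s0 OmE uE; have s20 : 0 < s ^+ 2 by rewrite exprn_gt0.
have Op : Om p by rewrite OmE /= subrr sqn0.
have umE : um = s ^+ 2 / 2.
  have [c [Oc Ec] _] := max_point; apply/eqP; rewrite eq_le; apply/andP; split.
    by rewrite -Ec uE //; have := sqn_ge0 (c - p); lra.
  have := le_umax (subset_closure Op); rewrite uE // subrr sqn0; lra.
have sE : Num.sqrt (2 * um) = s.
  by rewrite umE mulrC divfK // sqrtr_sqr gtr0_norm.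
have DE y i : Om y -> D i y = - (y 0 i - p 0 i).
  move=> Oy; have ds : is_derive y (ebase R i)
      (cst (s ^+ 2 / 2) + (- 2^-1) *: (fun y => sqn (y - p))) (- (y 0 i - p 0 i)).
    apply: (is_derive_eq (is_deriveD (is_derive_cst _ y (ebase R i))
      (is_deriveZ (- 2^-1) (sqn_derive p y i)))).
    by rewrite add0r /GRing.scale /= mulNr mulKf.
  rewrite -(derive_val (is_derive := ds)); apply: near_eq_derive.
  have [d d0 dO] := (iffLR (openP _)) oOm y Oy.
  apply: filterS (nbhsx_ballx y d d0) => z; rewrite -ball_normE /= distrC => /dO Oz.
  by rewrite uE // !fctE /GRing.scale /=; ring.
case: (sol) => _ _ _ _ cg.
have gE x i : closure Om x -> g i x = - (x 0 i - p 0 i).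
  move=> cx; apply/eqP/negPn/negP => ne.
  have e0 : 0 < `|g i x - - (x 0 i - p 0 i)| by rewrite normr_gt0 subr_eq0.
  pose e := `|g i x - - (x 0 i - p 0 i)|.
  have e20 : 0 < e / 2 by rewrite divr_gt0.
  have [d d0 dP] := (iffLR (continuous_withinP _ _)) (cg i).1 x cx _ e20.
  have m0 : 0 < Num.min d (e / 2) by rewrite lt_min d0.
  have [y Oy] := (iffLR (closureP _ _)) cx _ m0.
  rewrite lt_min => /andP[yd ye].
  have gy := dP y (subset_closure Oy) yd.
  have : e < e; last by rewrite ltxx.
  rewrite {1}/e; have -> : g i x - - (x 0 i - p 0 i) = - (g i y - g i x) - (y - x) 0 i.
    by rewrite ((cg i).2 y Oy) (DE y i Oy) !mxE; ring.
  apply: le_lt_trans (ler_normB _ _) _; rewrite normrN [ltRHS]splitr ltrD //.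
  by apply: le_lt_trans ye; exact: coord_le_norm.
have gnE x : bd Om x -> gradnorm g x = s.
  move=> [cx nOx]; rewrite /gradnorm (_ : \sum_i _ = sqn (x - p)); last first.
    by apply: eq_bigr => i _; rewrite gE // sqrrN !mxE.
  have -> : sqn (x - p) = s ^+ 2.
    apply/eqP; rewrite eq_le; apply/andP; split; last first.
      by rewrite leNgt; apply/negP => H; apply: nOx; rewrite OmE.
    have : closure [set x | sqn (x - p) <= s ^+ 2] x.
      by move: cx; apply: closureS; rewrite OmE => y /= /ltW.
    by move=> /(@closed_sqn_le R n p (s ^+ 2)).
  by rewrite sqrtr_sqr gtr0_norm.
(* Every boundary component has stress 1, and [bd_comp_nonempty] provides at least one, so the
   supremum is over the singleton 1. *)
rewrite /tauN (_ : [set tauS Om u g S | S in _] = [set 1]) ?sup1 //.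
have tS S : components (bd Om `&` closure N) S -> tauS Om u g S = 1.
  move=> [z Az SE]; rewrite /tauS sE (_ : [set gradnorm g y | y in S] = [set s]).
    by rewrite sup1 mulfV // gt_eqF.
  apply/seteqP; split => [_ [y Sy <-]|_ ->] /=.
    by apply: gnE; move: Sy; rewrite SE => /connected_component_sub[].
  exists z; last by apply: gnE; case: Az.
  by rewrite SE; exact: connected_component_refl.
apply/seteqP; split => [_ [S CS <-]|_ ->] /=; first exact: tS.
have [x Ax] := bd_comp_nonempty.
by exists (connected_component (bd Om `&` closure N) x); [|apply: tS]; exists x.
Qed.

Lemma equivalent_ball : equivalent Om u (@Omega0 R n) (@u0 R n) <->
  exists (p : V) (s : R), [/\ 0 < s, Om = [set x | sqn (x - p) < s ^+ 2] &
    forall x, Om x -> u x = (s ^+ 2 - sqn (x - p)) / 2].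
Proof.
split => [[l [c [l0 [OE uE]]]]|[p [s [s0 OE uE]]]].
  have ln : l != 0 by rewrite gt_eqF.
  exists (- (l^-1 *: c)), l^-1; rewrite invr_gt0.
  have cE x : l *: x + c = l *: (x - - (l^-1 *: c)).
    by rewrite opprK scalerDr scalerA mulfV // scale1r.
  have bE x : Omega0 (l *: x + c) <-> sqn (x - - (l^-1 *: c)) < l^-1 ^+ 2.
    rewrite /Omega0 /= enorm_lt_sqn // cE sqnZ expr1n exprVn.
    by rewrite -[X in _ <-> is_true (_ < X)]mul1r ltr_pdivlMr ?exprn_gt0 // mulrC.
  have OmE x : Om x <-> Omega0 (l *: x + c).
    rewrite OE; split => [Ox|[y Oy /addIr /(scalerI ln) <-//]].
    by exists x.
  split => //; first by apply/seteqP; split => x /=; rewrite -bE -OmE.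
  move=> x Ox; have := uE (l *: x + c); rewrite -OmE => /(_ Ox).
  rewrite addrK scalerA mulVf // scale1r /u0 sqr_enorm cE sqnZ => E.
  have l2 : l ^+ 2 != 0 by rewrite expf_neq0.
  by apply: (mulfI l2); rewrite -E exprVn; field.
have sn : s != 0 by rewrite gt_eqF.
(* The scaling maps the ball of radius s about p to the unit ball, hence the factor 1/s. *)
exists s^-1, (- (s^-1 *: p)); rewrite invr_gt0; split => //.
have cE x : s^-1 *: x + - (s^-1 *: p) = s^-1 *: (x - p) by rewrite scalerBr.
have bE x : enorm (s^-1 *: (x - p)) < 1 <-> sqn (x - p) < s ^+ 2.
  rewrite enorm_lt_sqn // sqnZ expr1n exprVn mulrC ltr_pdivrMr ?exprn_gt0 //.
  by rewrite mul1r.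
have yE y : y = s^-1 *: ((p + s *: y) - p).
  by rewrite addrC addKr scalerA mulVf // scale1r.
split => [|y].
  apply/seteqP; split => [y Hy|_ [x Ox <-]]; last first.
    by rewrite /Omega0 /= cE bE; move: Ox; rewrite OE.
  exists (p + s *: y); last by rewrite cE -yE.
  by rewrite OE /= -bE -yE.
rewrite /Omega0 /= => Hy.
have -> : s^-1^-1 *: (y - - (s^-1 *: p)) = p + s *: y.
  by rewrite invrK opprK scalerDr scalerA mulfV // scale1r addrC.
rewrite uE; last by rewrite OE /= -bE -yE.
by rewrite /u0 sqr_enorm [p + _]addrC addrK sqnZ exprVn; field.
Qed.

Lemma tauN_le1_ball : tauN Om u g N <= 1 -> equivalent Om u (@Omega0 R n) (@u0 R n).
Proof.
move=> t1; apply/equivalent_ball; apply: serrin_ball => x bx cx.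
have um0 : 0 <= 2 * um by rewrite mulr_ge0 // ltW // umax_gt0.
have S0 : 0 <= \sum_i g i x ^+ 2 by apply: sumr_ge0 => i _; exact: sqr_ge0.
rewrite -ler_sqrt //; apply: le_trans (le_tauN bx cx) _.
by rewrite ler_piMl // sqrtr_ge0.
Qed.

Lemma equivalent_tauN : equivalent Om u (@Omega0 R n) (@u0 R n) -> tauN Om u g N = 1.
Proof. by move=> /equivalent_ball[p [s [s0 OE uE]]]; exact: tauN_ball OE uE. Qed.

(** A stress below 1 would already force the ball, whose stress is exactly 1. *)
Lemma tauN_ge1 : 1 <= tauN Om u g N.
Proof.
rewrite leNgt; apply/negP => t1; have /equivalent_tauN E := tauN_le1_ball (ltW t1).
by move: t1; rewrite E ltxx.
Qed.

Lemma tauN_eq1 : tauN Om u g N = 1 <-> equivalent Om u (@Omega0 R n) (@u0 R n).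
Proof.
split; last exact: equivalent_tauN.
by move=> t1; apply: tauN_le1_ball; rewrite t1.
Qed.

End Serrin.

Unset Implicit Arguments.

Theorem theorem2p1 (R : realType) (n : nat) (Om : set 'rV[R]_n)
  (u : 'rV[R]_n -> R) (g : 'I_n -> 'rV[R]_n -> R) (N : set 'rV[R]_n) :
  (3 <= n)%N ->
  smooth_bounded_domain Om ->
  serrin_solution Om u g ->
  components (Om `\` MAX Om u) N ->
  [/\ 1 <= tauN Om u g N,
      0 <= core_radius n (tauN Om u g N) &
      (core_radius n (tauN Om u g N) = 0 <->
       equivalent Om u (@Omega0 R n) (@u0 R n))].
Proof.
move=> n3 [oOm cOm Om0 bOm _] sol CN.
have t1 := tauN_ge1 n3 oOm cOm Om0 bOm sol CN.
have [E0 E1] := core_radius_spec n3 t1.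
split => //; apply: iff_trans E1 _.
exact: tauN_eq1 n3 oOm cOm Om0 bOm sol CN.
Qed.
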